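(* Let $P\in\mathbb{R}^{n\times n}$ be a $d$-sparse transition probability matrix, $A=P^\top-I$, $\varepsilon>0$ and $0<\delta<1$. Let $$N\ge 4\varepsilon^{-2}\bigl(\ln(2n)+\ln(n)+16\ln(1/\delta)\bigr).$$ Then the algorithm GK (described in the context), run for $N$ iterations with the constant step-sizes $\gamma_x=\sqrt{2(\log n)/N}$ and $\gamma_y=\sqrt{2(\log(2n))/N}$, results in a point $(\bar x_N,\bar y_N)$ such that, with probability at least $1-\delta$, $$\|A\bar x_N\|_\infty\le\varepsilon .$$ Moreover, the total running time of the algorithm (with $N$ the smallest such number of iterations) is bounded from above as $$T=O\left(n+\frac{d\log n\,\log\frac{n}{\delta}}{\varepsilon^2}\right).$$
   Context: A transition probability matrix $P\in\mathbb{R}^{n\times n}$ is a matrix with non-negative entries whose rows each sum to $1$ (so a stationary distribution is a probability vector $x$ with $P^\top x=x$). $P$ is $d$-sparse if each row and each column contains at most $d$ non-zero entries. $\Delta_1^m=\{x\in\mathbb{R}^m:\sum_i x^i=1,\ x^i\ge0\}$. $\log=\ln$ is the natural logarithm. Let $J=[I_n,-I_n]\in\mathbb{R}^{n\times 2n}$ and $\tilde A=A^\top J\in\mathbb{R}^{n\times 2n}$, so that $\|Ax\|_\infty=\max_{y\in\Delta_1^{2n}}\langle x,\tilde A y\rangle$; the problem $\min_{x\in\Delta_1^n}\max_{y\in\Delta_1^{2n}}\langle x,\tilde Ay\rangle$ has value $0$. Algorithm GK. Initialize $p_1=(1/n,\dots,1/n)\in\Delta_1^n$ and $\pi_1=(1/(2n),\dots,1/(2n))\in\Delta_1^{2n}$.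 At each iteration $k=1,\dots,N$: Player A draws at random $i_k\in\{1,\dots,2n\}$ with $\mathbb{P}(i_k=i)=\pi_k^i$ and sets $y_k$ to be the $i_k$-th coordinate unit vector of $\mathbb{R}^{2n}$; Player B draws at random $j_k\in\{1,\dots,n\}$ with $\mathbb{P}(j_k=j)=p_k^j$ and sets $x_k$ to be the $j_k$-th coordinate unit vector of $\mathbb{R}^n$ (the draws are independent given the past). The distributions are updated, up to normalization, by $$\pi_{k+1}^i\propto\pi_k^i\exp\bigl(\gamma_y\tilde A_{j_k,i}\bigr),\qquad p_{k+1}^j\propto p_k^j\exp\bigl(-\gamma_x\tilde A_{j,i_k}\bigr).$$ The output is the pair of averages $\bar x_N=\frac1N\sum_{k=1}^N x_k$, $\bar y_N=\frac1N\sum_{k=1}^N y_k$. Implementation: each of the unnormalized distributions $p$ and $\pi$ is stored in a balanced binary tree whose leaves carry the unnormalized probabilities and whose internal nodes carry the total weight of the leaves below them; changing one leaf updates the path to the root, and sampling descends from the root choosing a child with probability proportional to its weight. The sums $k\bar x_k$, $k\bar y_k$ are updated sparsely. Running time is the total number of arithmetic operations, including initialization; the constant in $O(\cdot)$ is absolute.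
   Formalization: The running-time bound is proved for n ≥ 2 (for n = 1, log n = 0 and it fails as ε → 0), and for an implementation that skips the unused update of the distributions after the last draw (with it, the bound fails for huge ε and d = n). *)

(* Defs.v *)
From HB Require Import structures.
From mathcomp Require Import all_boot all_order all_algebra.
From mathcomp Require Import all_classical all_reals all_analysis.

Set Implicit Arguments.
Unset Strict Implicit.
Unset Printing Implicit Defensive.
Import Order.TTheory GRing.Theory Num.Theory.
Import numFieldNormedType.Exports.
Local Open Scope ring_scope.

Definition is_transition_matrix (R : realType) (n : nat) (P : 'M[R]_n) : Prop :=
  (forall i j, 0 <= P i j) /\ (forall i, \sum_j P i j = 1).

Definition is_sparse (R : realType) (n d : nat) (P : 'M[R]_n) : Prop :=
  (forall i, (#|[set j | (P i j != 0)%R]| <= d)%N) /\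
  (forall j, (#|[set i | (P i j != 0)%R]| <= d)%N).

Definition residual_mx (R : realType) (n : nat) (P : 'M[R]_n) : 'M[R]_n :=
  P^T - 1%:M.

Definition J_mx (R : realType) (n : nat) : 'M[R]_(n, n + n) :=
  row_mx 1%:M (- 1%:M).

Definition game_mx (R : realType) (n : nat) (P : 'M[R]_n) : 'M[R]_(n, n + n) :=
  (residual_mx P)^T *m J_mx R n.

(** * The random process *)

Section Process.
Variables (R : realType) (n : nat) (P : 'M[R]_n) (gx gy : R).

(* The pair (i_k, j_k) of indices drawn at one iteration. *)
Definition draws : Type := ('I_(n + n) * 'I_n)%type.

Definition normalize (m : nat) (q : 'cV[R]_m) : 'cV[R]_m :=
  (\sum_i q i 0)^-1 *: q.

Definition next_pi (pi : 'cV[R]_(n + n)) (j : 'I_n) : 'cV[R]_(n + n) :=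
  normalize (\col_i (pi i 0 * expR (gy * game_mx P j i))).

Definition next_p (p : 'cV[R]_n) (i : 'I_(n + n)) : 'cV[R]_n :=
  normalize (\col_j (p j 0 * expR (- gx * game_mx P j i))).

(* Probability that the successive draws are w when the current distributions
   are pi and p: given the past, i_k and j_k are independent, with
   respective laws pi_k and p_k. *)
Fixpoint path_prob (pi : 'cV[R]_(n + n)) (p : 'cV[R]_n) (w : seq draws) : R :=
  if w is (i, j) :: w' then
    pi i 0 * p j 0 * path_prob (next_pi pi j) (next_p p i) w'
  else 1.

Definition averages (N : nat) (w : N.-tuple draws) :
    'cV[R]_n * 'cV[R]_(n + n) :=
  (N%:R^-1 *: \sum_(k < N) delta_mx (tnth w k).2 0,
   N%:R^-1 *: \sum_(k < N) delta_mx (tnth w k).1 0).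

(* Probability that the output (xbar_N, ybar_N) satisfies E. *)
Definition GK_prob (N : nat) (E : pred ('cV[R]_n * 'cV[R]_(n + n))) : R :=
  \sum_(w : N.-tuple draws | E (averages w))
    path_prob (const_mx (n + n)%:R^-1) (const_mx n%:R^-1) w.

End Process.

(** * Randomized real-number programs and their running time *)

Inductive arith (R : Type) : Type :=
| Add of R & R
| Sub of R & R
| Mul of R & R
| Div of R & R
| Exp of R
| Ln of R
| Sqrt of R.

Definition arith_eval (R : realType) (o : arith R) : R :=
  match o with
  | Add x y => x + y
  | Sub x y => x - y
  | Mul x y => x * y
  | Div x y => x / y
  | Exp x => expR x
  | Ln x => ln x
  | Sqrt x => Num.sqrt x
  end.

(* Step pays for a memory access (a tree node, an array cell, an entry of a
   sparse row) together with the O(1) index computations that go with it.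
   Flip w branches on true with probability w and on false with
   probability 1 - w. *)
Inductive prog (R T : Type) : Type :=
| Ret of T
| Op of arith R & (R -> prog R T)
| Step of prog R T
| Flip of R & (bool -> prog R T).

Arguments Ret {R T}.
Arguments Op {R T}.
Arguments Step {R T}.
Arguments Flip {R T}.

Fixpoint bind (R S T : Type) (c : prog R S) (f : S -> prog R T) : prog R T :=
  match c with
  | Ret a => f a
  | Op o k => Op o (fun r => bind (k r) f)
  | Step c' => Step (bind c' f)
  | Flip w k => Flip w (fun b => bind (k b) f)
  end.

Declare Scope prog_scope.
Delimit Scope prog_scope with prog.
Notation "'let!' x ':=' c 'in' f" := (bind c (fun x => f))
  (at level 200, x name, c at level 200, f at level 200,
   format "'[v' 'let!'  x  ':='  c  'in' '/' f ']'") : prog_scope.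
Local Open Scope prog_scope.

Definition op (R : Type) (o : arith R) : prog R R := Op o Ret.

Fixpoint prog_prob (R : realType) (T : Type) (E : pred T) (c : prog R T) : R :=
  match c with
  | Ret a => (E a)%:R
  | Op o k => prog_prob E (k (arith_eval o))
  | Step c' => prog_prob E c'
  | Flip w k => w * prog_prob E (k true) + (1 - w) * prog_prob E (k false)
  end.

(* Worst case over the random choices; every Op, Step and Flip costs 1. *)
Fixpoint run_time (R : realType) (T : Type) (c : prog R T) : nat :=
  match c with
  | Ret _ => 0
  | Op o k => (run_time (k (arith_eval o))).+1
  | Step c' => (run_time c').+1
  | Flip _ k => (maxn (run_time (k true)) (run_time (k false))).+1
  end.

(** * The implementation *)

Section Implementation.
Variable R : realType.

(* A tree with m leaves has m./2 of them in its left subtree; the functions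
   below carry m to navigate. Leaves are numbered from left to right. *)
Inductive wtree : Type :=
| Leaf of R
| Node of R & wtree & wtree.

Definition weight (t : wtree) : R :=
  match t with Leaf w => w | Node w _ _ => w end.

(* h is fuel for the recursion: h >= m suffices. *)
Fixpoint build_tree (h m : nat) (w : R) : prog R wtree :=
  Step (if h is h'.+1 then
    if (m <= 1)%N then Ret (Leaf w) else
      let! l := build_tree h' m./2 w in
      let! r := build_tree h' (m - m./2) w in
      let! s := op (Add (weight l) (weight r)) in
      Ret (Node s l r)
  else Ret (Leaf w)).

(* Multiply the weight of leaf i by c. *)
Fixpoint scale_leaf (m : nat) (t : wtree) (i : nat) (c : R) : prog R wtree :=
  Step (match t with
  | Leaf w => let! w' := op (Mul w c) in Ret (Leaf w')
  | Node _ l r =>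
    if (i < m./2)%N then
      let! l' := scale_leaf m./2 l i c in
      let! s := op (Add (weight l') (weight r)) in
      Ret (Node s l' r)
    else
      let! r' := scale_leaf (m - m./2) r (i - m./2) c in
      let! s := op (Add (weight l) (weight r')) in
      Ret (Node s l r')
  end).

Fixpoint sample_leaf (m : nat) (t : wtree) : prog R nat :=
  Step (match t with
  | Leaf _ => Ret 0%N
  | Node w l r =>
    let! q := op (Div (weight l) w) in
    Flip q (fun b =>
      if b then sample_leaf m./2 l
      else let! i := sample_leaf (m - m./2) r in Ret (m./2 + i)%N)
  end).

(* Arrays are sequences, with unit-cost access to each cell. *)
Fixpoint fill (m : nat) (v : R) : prog R (seq R) :=
  if m is m'.+1 then Step (let! s := fill m' v in Ret (v :: s))
  else Ret [::].

Definition incr_cell (s : seq R) (i : nat) : prog R (seq R) :=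
  Step (let! v := op (Add (nth 0 s i) 1) in Ret (set_nth 0 s i v)).

Fixpoint divide_cells (s : seq R) (c : R) : prog R (seq R) :=
  if s is v :: s' then
    Step (let! u := op (Div v c) in
          let! s'' := divide_cells s' c in
          Ret (u :: s''))
  else Ret [::].

(* A sparse vector is the sequence of its (index, entry) pairs. *)
Definition svec : Type := seq (nat * R).

(* Input format of the matrix: its sparse rows and its sparse columns. *)
Definition sparse_rows (n : nat) (P : 'M[R]_n) : seq svec :=
  [seq [seq (val j, P i j) | j <- enum 'I_n & P i j != 0] | i <- enum 'I_n].

Definition sparse_cols (n : nat) (P : 'M[R]_n) : seq svec :=
  sparse_rows P^T.

(* Subtract the c-th unit vector: turns row (column) c of P into
   row (column) c of P - I = A^T. *)
Fixpoint sub_unit (c : nat) (s : svec) : prog R svec :=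
  Step (if s is (i, a) :: s' then
    if i == c then let! a' := op (Sub a 1) in Ret ((i, a') :: s')
    else let! s'' := sub_unit c s' in Ret ((i, a) :: s'')
  else Ret [:: (c, -1)]).

(* s is row j_k of A^T; row j_k of A^T J is s followed by - s. *)
Fixpoint update_pi (n : nat) (gy : R) (s : svec) (t : wtree) : prog R wtree :=
  Step (if s is (i, a) :: s' then
    let! e := op (Mul gy a) in
    let! u := op (Exp e) in
    let! t1 := scale_leaf (n + n) t i u in
    let! e' := op (Sub 0 e) in
    let! v := op (Exp e') in
    let! t2 := scale_leaf (n + n) t1 (n + i) v in
    update_pi n gy s' t2
  else Ret t).

(* The factor of leaf j is expR (g * a), for each entry (j, a) of s. *)
Fixpoint update_p (n : nat) (g : R) (s : svec) (t : wtree) : prog R wtree :=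
  Step (if s is (j, a) :: s' then
    let! e := op (Mul g a) in
    let! u := op (Exp e) in
    let! t1 := scale_leaf n t j u in
    update_p n g s' t1
  else Ret t).

(* sx and sy hold the sums k * xbar_k and k * ybar_k. After the last draw the
   weights are not used any more and are left as they are. *)
Fixpoint GK_loop (n : nat) (rows cols : seq svec) (gx gy : R) (k : nat)
    (tp tpi : wtree) (sx sy : seq R) : prog R (seq R * seq R) :=
  Step (if k is k'.+1 then
    let! i := sample_leaf (n + n) tpi in
    let! j := sample_leaf n tp in
    let! sx' := incr_cell sx j in
    let! sy' := incr_cell sy i in
    if k' == 0%N then Ret (sx', sy') else
      let! row := sub_unit j (nth [::] rows j) in
      let! tpi' := update_pi n gy row tpi in
      let c := if (i < n)%N then i else (i - n)%N in
      let! col := sub_unit c (nth [::] cols c) in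
      let! g := (if (i < n)%N then op (Sub 0 gx) else Ret gx) in
      let! tp' := update_p n g col tp in
      GK_loop n rows cols gx gy k' tp' tpi' sx' sy'
  else Ret (sx, sy)).

(* The step-size sqrt (2 (ln m) / N). *)
Definition step_size (m N : nat) : prog R R :=
  let! l := op (Ln m%:R) in
  let! l2 := op (Mul 2 l) in
  let! q := op (Div l2 N%:R) in
  op (Sqrt q).

Definition col_of_seq (m : nat) (s : seq R) : 'cV[R]_m := \col_i nth 0 s i.

Definition GK_program (n : nat) (rows cols : seq svec) (N : nat) :
    prog R ('cV[R]_n * 'cV[R]_(n + n)) :=
  let! gx := step_size n N in
  let! gy := step_size (2 * n) N in
  let! wp := op (Div 1 n%:R) in
  let! tp := build_tree n n wp in
  let! wpi := op (Div 1 (n + n)%:R) in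
  let! tpi := build_tree (n + n) (n + n) wpi in
  let! sx0 := fill n 0 in
  let! sy0 := fill (n + n) 0 in
  let! s := GK_loop n rows cols gx gy N tp tpi sx0 sy0 in
  let! xbar := divide_cells s.1 N%:R in
  let! ybar := divide_cells s.2 N%:R in
  Ret (col_of_seq n xbar, col_of_seq (n + n) ybar).

End Implementation.

(* Main.v *)
Require Import Defs.
From HB Require Import structures.
From mathcomp Require Import all_boot all_order all_algebra.
From mathcomp Require Import all_classical all_reals all_analysis.
From mathcomp Require Import ring lra zify.

Set Implicit Arguments.
Unset Strict Implicit.
Unset Printing Implicit Defensive.
Import Order.TTheory GRing.Theory Num.Theory.
Import numFieldNormedType.Exports.
Local Open Scope ring_scope.

(** Why the theorem holds.

    Accuracy. Write G for the matrix of the game. After the draws w the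
    maximizing player has cumulated gains S_i (sums of entries G j_k i) and the
    minimizing player cumulated losses T_j (sums of entries G j i_k). Since the
    columns of J are the signed unit vectors, the residual of the averaged
    output has norm max_i S_i / N. The proof follows the potential

      ( sum_i pi_i exp (gy S_i) ) ^ (l / gy) * ( sum_j p_j exp (- gx T_j) ) ^ (l / gx)

    for a parameter l. It is multiplicative along the run ([potential_cons]),
    because the weights of the algorithm are exactly the normalized summands.
    Given the past, the two draws are independent, and the mean payoff v enters
    the growth of the first factor as exp (l v) and that of the second one as
    exp (- l v): it cancels, so the mean of the potential grows by a factor
    exp kap at most in each iteration ([potential_mean]). On a run with
    max_i S_i > N eps the first factor is large, and the second one is never
    small, because some T_j is nonpositive ([loss_le0]): at a coordinate j where
    a vector u is maximal, (P u)_j <= u_j. The Markov inequality then bounds the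
    probability of failure ([GK_success_ge]).

    The value of l matters. Bounding the regrets of the players path by path and
    adding an Azuma bound for the noise gives
    sqrt 2 (sqrt a + sqrt b) + 2 sqrt c <= sqrt N eps, with a = ln (2n), b = ln n
    and c = ln (1 / delta); by the Cauchy-Schwarz inequality this asks for
    N eps^2 >= (17/4) (a + b + 16 c), just above the factor 4 of the theorem. For
    c <= N gx^2 the choice l = gx makes both exponents at most 1, and concavity
    of the powers removes the cost of the noise altogether
    ([potential_step_small]). For larger c the choice l = sqrt (c / N) pays for
    the noise with exp (l^2) ([potential_step_any]), and the coefficient 16 of c
    leaves enough room ([step_size_tuning]).

    Law of the output. Apart from the descents in the trees the program makes no
    random choice, so its runs are described by Hoare triples ([terminates]) that
    also count steps. The invariant of the loop is that each tree stores the
    current distribution up to normalization ([stores]); multiplying the leaves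
    met by a sparse row or column then amounts to one multiplicative update, and
    a descent draws from the stored distribution.

    Running time. A tree with 2n leaves has height O(log n), a row or column of
    P - I has at most d + 1 entries, and the weights are updated N - 1 times
    only. Minimality of N gives N - 1 < 4 (a + b + 16 c) / eps^2, so the updates cost
    O(d log n log (n / delta) / eps^2), and everything else costs O(n) plus
    O(log n) per iteration. *)

(** * Moment bounds for one player *)

Lemma ger0_is_derive_le (R : realType) (f df : R -> R) (s : R) :
  0 <= s -> (forall x : R, is_derive x 1 f (df x)) ->
  (forall x, 0 <= x -> 0 <= df x) -> f 0 <= f s.
Proof.
move=> s0 fd df0.
have [|c cs fE] := MVT_segment s0 (fun x _ => fd x).
  by apply: derivable_within_continuous => x _; case: (fd x).
rewrite -subr_ge0 fE subr0 mulr_ge0// df0//.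
by move: cs; rewrite in_itv/= => /andP[].
Qed.

(** The left side is the mean [E] of [expR (s * x)] for [x] in {-1, 1} with mean
    [mu]. The function [s |-> s * mu + s ^+ 2 / 2 - ln E] vanishes at 0 together with
    its derivative, and its second derivative is a square. *)
Lemma two_point_mgf (R : realType) (mu s : R) :
  -1 <= mu -> mu <= 1 -> 0 <= s ->
  (1 + mu) / 2 * expR s + (1 - mu) / 2 * expR (- s) <=
    expR (s * mu + s ^+ 2 / 2).
Proof.
move=> mu1 mu2 s0.
pose u (x : R) := (1 + mu) / 2 * expR x + (1 - mu) / 2 * expR (- x).
pose u' (x : R) := (1 + mu) / 2 * expR x - (1 - mu) / 2 * expR (- x).
have upos x : 0 < u x.
  have := expR_gt0 x; have := expR_gt0 (- x); rewrite /u.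
  by move=> e1 e2; have [?|?] := leP mu 0; nra.
have ud (x : R) : is_derive x 1 u (u' x).
  by rewrite /u; apply: is_derive_eq; rewrite /u' /GRing.scale/=; ring.
have u'd (x : R) : is_derive x 1 u' (u x).
  by rewrite /u'; apply: is_derive_eq; rewrite /u /GRing.scale/=; ring.
have vd (x : R) : is_derive x 1 (fun x => u' x * (u x)^-1) (1 - (u' x / u x) ^+ 2).
  have ux0 : u x != 0 by rewrite gt_eqF.
  have iv := is_deriveV ux0 (ud x).
  apply: is_derive_eq; rewrite /GRing.scale/=; field.
  done.
have lnud (x : R) : is_derive x 1 (fun x => ln (u x)) (u' x / u x).
  have h := is_derive1_ln (upos x).
  by apply: is_derive_eq; rewrite /GRing.scale/= mulrC.
(* [g] is the difference of the exponents and [dg] its derivative. *)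
pose dg (x : R) := mu + x - u' x * (u x)^-1.
pose g (x : R) := x * mu + x ^+ 2 / 2 - ln (u x).
have dgd (x : R) : is_derive x 1 dg ((u' x / u x) ^+ 2).
  by rewrite /dg; apply: is_derive_eq; ring.
have gd (x : R) : is_derive x 1 g (dg x).
  rewrite /g; apply: is_derive_eq; rewrite /dg /GRing.scale/=.
  by move: (u' x / u x) => q; field.
have u0 : u 0 = 1 by rewrite /u oppr0 expR0; field.
have dg0 x : 0 <= x -> 0 <= dg x.
  move=> x0; have := ger0_is_derive_le x0 dgd (fun y _ => sqr_ge0 _).
  suff -> : dg 0 = 0 by [].
  by rewrite /dg u0 /u' oppr0 expR0; field.
have := ger0_is_derive_le s0 gd dg0.
have -> : g 0 = 0 by rewrite /g u0 ln1; ring.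
rewrite subr_ge0 => h.
by rewrite -[leLHS](lnK (upos s)) ler_expR.
Qed.

Lemma expR_chord (R : realType) (s x : R) : -1 <= x -> x <= 1 ->
  expR (s * x) <= (1 + x) / 2 * expR s + (1 - x) / 2 * expR (- s).
Proof.
move=> x1 x2.
have t0 : 0 <= (1 + x) / 2 by lra.
have t1 : (1 + x) / 2 <= 1 by lra.
have := @convex_expR R (Itv01 t0 t1) s (- s).
rewrite !convRE/= /unstable.onem => h.
have -> : s * x = (1 + x) / 2 * s + (1 - (1 + x) / 2) * - s by field.
by apply: le_trans h _; rewrite lerD2l (_ : 1 - (1 + x) / 2 = (1 - x) / 2)//; field.
Qed.

Definition is_dist (R : realType) (I : finType) (p : I -> R) : Prop :=
  (forall i, 0 <= p i) /\ \sum_i p i = 1.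

Lemma dist_mean_bound (R : realType) (I : finType) (p x : I -> R) :
  is_dist p -> (forall i, -1 <= x i <= 1) -> -1 <= \sum_i p i * x i <= 1.
Proof.
move=> [p0 p1] x1; apply/andP; split.
  have -> : -1 = \sum_i p i * -1 by rewrite -mulr_suml p1 mul1r.
  by apply: ler_sum => i _; rewrite ler_wpM2l//; case/andP: (x1 i).
rewrite [leRHS](_ : 1 = \sum_i p i * 1); last by rewrite -mulr_suml p1 mul1r.
by apply: ler_sum => i _; rewrite ler_wpM2l//; case/andP: (x1 i).
Qed.

Lemma expR_mean_gt0 (R : realType) (I : finType) (p x : I -> R) :
  is_dist p -> 0 < \sum_i p i * expR (x i).
Proof.
move=> [p0 p1].
have : 0 <= \sum_i p i * expR (x i).
  by apply: sumr_ge0 => i _; rewrite mulr_ge0// expR_ge0.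
rewrite le_eqVlt => /orP[/eqP/esym/eqP|//].
rewrite psumr_eq0 => [/allP Z0|i _]; last by rewrite mulr_ge0// expR_ge0.
suff : \sum_i p i = 0 by move/eqP; rewrite p1 oner_eq0.
apply: big1 => i _; have := Z0 i (mem_index_enum _) => /=.
by rewrite mulf_eq0 (gt_eqF (expR_gt0 _)) orbF => /eqP.
Qed.

(** Each [expR (s * x i)] is at most its chord, so the sum is at most the mgf of the
    two-point law on -1 and 1 that has the same mean. *)
Lemma hoeffding_mgf (R : realType) (I : finType) (p x : I -> R) (s : R) :
  is_dist p -> (forall i, -1 <= x i <= 1) -> 0 <= s ->
  \sum_i p i * expR (s * x i) <= expR (s * \sum_i p i * x i + s ^+ 2 / 2).
Proof.
move=> pd x1 s0; have /andP[m1 m2] := dist_mean_bound pd x1.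
have [p0 p1] := pd.
apply: le_trans (two_point_mgf m1 m2 s0).
rewrite (le_trans (ler_sum _ (fun i _ => ler_wpM2l (p0 i) (expR_chord s
  (andP (x1 i)).1 (andP (x1 i)).2))))//.
rewrite [leRHS](_ : _ = (\sum_i p i + \sum_i p i * x i) / 2 * expR s +
  (\sum_i p i - \sum_i p i * x i) / 2 * expR (- s)); last by rewrite p1.
rewrite -big_split/= -sumrB !mulr_suml -big_split/=.
by rewrite le_eqVlt; apply/orP; left; apply/eqP/eq_bigr => i _; ring.
Qed.

(** A power with exponent [t <= 1] is concave, hence below its tangent at [m]. For
    [m] the mean of [y], averaging this bound gives the Jensen inequality. *)
Lemma powR_tangent (R : realType) (y m t : R) :
  0 < y -> 0 < m -> 0 <= t -> t <= 1 ->
  y `^ t <= m `^ t * (1 + t * (y / m - 1)).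
Proof.
move=> y0 m0 t0 t1; have ym0 : 0 < y / m by rewrite divr_gt0.
have {1}-> : y = m * (y / m) by field; exact: lt0r_neq0.
rewrite powRM ?(ltW m0) ?(ltW ym0)//.
rewrite ler_pM2l ?powR_gt0//.
have := @convex_expR R (Itv01 t0 t1) (ln (y / m)) 0.
rewrite !convRE/= /unstable.onem mulr0 addr0 expR0 lnK// mulr1.
by rewrite [t * ln _]mulrC expRM lnK// => /le_trans; apply; lra.
Qed.

(** In this section [q] is the current distribution of a player whose reward for
    action [i] is [M j i] when the opponent draws [j] with law [p], and [Z j] is the
    factor by which the total weight of that player grows. *)
Section OnePlayer.
Variables (R : realType) (I J : finType) (p : J -> R) (q : I -> R).
Variables (M : J -> I -> R) (g l : R).
Hypotheses (pd : is_dist p) (qd : is_dist q).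
Hypotheses (M1 : forall j i, -1 <= M j i <= 1) (g0 : 0 < g) (l0 : 0 <= l).

Let v := \sum_j p j * \sum_i q i * M j i.
Let Z j := \sum_i q i * expR (g * M j i).

Let Z_gt0 j : 0 < Z j.
Proof. exact: expR_mean_gt0. Qed.

(** Hoeffding is applied once, to the product law of the two draws; concavity of the
    power then moves the mean over [j] inside, so the randomness of [j] costs
    nothing. *)
Lemma small_power_step : l <= g ->
  \sum_j p j * Z j `^ (l / g) <= expR (l * v + l * g / 2).
Proof.
move=> lg; have [p0 p1] := pd.
set m := expR (g * v + g ^+ 2 / 2).
have m0 : 0 < m by exact: expR_gt0.
have t0 : 0 <= l / g by rewrite divr_ge0// ltW.
have t1 : l / g <= 1 by rewrite ler_pdivrMr// mul1r.
have -> : expR (l * v + l * g / 2) = m `^ (l / g).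
  rewrite /m -expRM; congr expR; field; exact: lt0r_neq0.
have EZ : \sum_j p j * Z j <= m.
  rewrite /Z /m /v; under eq_bigr do rewrite mulr_sumr.
  pose pq (a : J * I) := p a.1 * q a.2.
  have pqd : is_dist pq.
    split => [a|]; first by rewrite mulr_ge0 ?pd.1 ?qd.1.
    rewrite -(pair_bigA _ (fun j i => p j * q i))/= -p1.
    by apply: eq_bigr => j _; rewrite -mulr_sumr qd.2 mulr1.
  have := hoeffding_mgf pqd (fun a => M1 a.1 a.2) (ltW g0).
  rewrite -(pair_bigA _ (fun j i => p j * q i * expR (g * M j i)))/=.
  rewrite -(pair_bigA _ (fun j i => p j * q i * M j i))/=.
  under eq_bigr do under eq_bigr do rewrite -mulrA.
  under [X in g * X]eq_bigr do under eq_bigr do rewrite -mulrA.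
  by under [X in g * X]eq_bigr do rewrite -mulr_sumr.
apply: (@le_trans _ _ (\sum_j p j * (m `^ (l / g) * (1 + l / g * (Z j / m - 1))))).
  by apply: ler_sum => j _; rewrite ler_wpM2l//; exact: powR_tangent.
have -> : \sum_j p j * (m `^ (l / g) * (1 + l / g * (Z j / m - 1))) =
   m `^ (l / g) * (\sum_j p j + l / g * ((\sum_j p j * Z j) / m - \sum_j p j)).
  rewrite mulr_suml -sumrB [l / g * _]mulr_sumr -big_split/= mulr_sumr.
  by apply: eq_bigr => j _; ring.
rewrite p1 -[leRHS]mulr1 ler_wpM2l ?powR_ge0//.
rewrite gerDl mulr_ge0_le0// subr_le0 ler_pdivrMr// mul1r.
exact: EZ.
Qed.

(** For a convex power the means cannot be exchanged: Hoeffding is applied to the law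
    [q] for fixed [j], then to the conditional mean of the reward as a function of
    [j], which costs the extra [l ^+ 2 / 2]. *)
Lemma any_power_step :
  \sum_j p j * Z j `^ (l / g) <= expR (l * v + l * g / 2 + l ^+ 2 / 2).
Proof.
have [p0 p1] := pd.
have mb j := dist_mean_bound qd (M1 j).
rewrite [_ + l * g / 2]addrC -addrA expRD.
apply: le_trans (ler_wpM2l (expR_ge0 _) (hoeffding_mgf pd mb l0)).
rewrite mulr_sumr; apply: ler_sum => j _.
rewrite mulrCA ler_wpM2l// -expRD.
have -> : l * g / 2 + l * (\sum_i q i * M j i) =
    (g * (\sum_i q i * M j i) + g ^+ 2 / 2) * (l / g).
  by field; exact: lt0r_neq0.
rewrite expRM ge0_ler_powR ?nnegrE ?expR_ge0 ?(ltW (Z_gt0 _))//.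
  by rewrite divr_ge0// ltW.
exact: (hoeffding_mgf qd (M1 j) (ltW g0)).
Qed.

End OnePlayer.

(** * The game and the exponential potential *)

Lemma sum_tupleS (V : nmodType) (T : finType) (k : nat) (F : seq T -> V) :
  \sum_(w : k.+1.-tuple T) F w = \sum_x \sum_(w : k.-tuple T) F (x :: w).
Proof.
rewrite (pair_bigA _ (fun x (w : k.-tuple T) => F (x :: w)))/=.
rewrite (reindex (fun a : T * k.-tuple T => [tuple of a.1 :: a.2])) //=.
exists (fun w => (thead w, [tuple of behead w])) => [[x w] _|w _] /=.
  by congr (_, _); exact: val_inj.
by rewrite -tuple_eta.
Qed.

Lemma sum_tuple0 (V : nmodType) (T : finType) (F : seq T -> V) :
  \sum_(w : 0.-tuple T) F w = F [::].
Proof.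
rewrite (bigD1 [tuple])//= big1 ?addr0// => w /eqP[]; exact: tuple0.
Qed.

Lemma sum_drawsS (V : nmodType) (n k : nat) (F : seq (draws n) -> V) :
  \sum_(w : k.+1.-tuple (draws n)) F w =
  \sum_i \sum_j \sum_(w : k.-tuple (draws n)) F ((i, j) :: w).
Proof.
rewrite sum_tupleS.
rewrite (pair_bigA _ (fun i j => \sum_(w : k.-tuple (draws n)) F ((i, j) :: w))).
by apply: eq_bigr => -[i j] _.
Qed.

Section Game.
Variables (R : realType) (n : nat) (P : 'M[R]_n).

Lemma game_mxE : game_mx P = row_mx (P - 1%:M) (- (P - 1%:M)).
Proof.
rewrite /game_mx /residual_mx /J_mx mul_mx_row mulmxN mulmx1.
by rewrite linearB/= trmxK trmx1.
Qed.

Lemma game_mxl (j i : 'I_n) : game_mx P j (lshift n i) = P j i - (j == i)%:R.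
Proof. by rewrite game_mxE row_mxEl !mxE. Qed.

Lemma game_mxr (j i : 'I_n) : game_mx P j (rshift n i) = - (P j i - (j == i)%:R).
Proof. by rewrite game_mxE row_mxEr !mxE. Qed.

Hypothesis tP : is_transition_matrix P.

Lemma transition_le1 (j i : 'I_n) : P j i <= 1.
Proof.
have [P0 P1] := tP; rewrite -(P1 j) (bigD1 i)//= lerDl.
by apply: sumr_ge0.
Qed.

(** Each entry of [P - 1%:M] lies in [-1, 1] because its diagonal part is
    [P j j - 1]. *)
Lemma game_mx_bound (j : 'I_n) (i : 'I_(n + n)) : -1 <= game_mx P j i <= 1.
Proof.
have [P0 P1] := tP.
have b (i' : 'I_n) : -1 <= P j i' - (j == i')%:R <= 1.
  have := P0 j i'; have := transition_le1 j i'.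
  by case: (j == i') => /= h1 h2; apply/andP; lra.
case: (split_ordP i) => i' ->; rewrite ?game_mxl ?game_mxr//.
by rewrite lerNl opprK lerNl andbC b.
Qed.

Definition gain (w : seq (draws n)) (i : 'I_(n + n)) : R :=
  \sum_(a <- w) game_mx P a.2 i.
Definition loss (w : seq (draws n)) (j : 'I_n) : R :=
  \sum_(a <- w) game_mx P j a.1.

(** The loss vector is [(P - 1) u], where [u] cumulates the columns of [J] that were
    drawn, and each row of [P] averages [u]: a maximal coordinate of [u] does not
    increase. *)
Lemma loss_le0 (w : seq (draws n)) : (0 < n)%N -> exists j, loss w j <= 0.
Proof.
move=> n0; have [P0 P1] := tP.
pose u (i : 'I_n) : R := \sum_(a <- w) J_mx R n i a.1.
have lossE j : loss w j = \sum_i P j i * (u i - u j).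
  rewrite (eq_bigr (fun i => P j i * u i - P j i * u j)); last first.
    by move=> i _; rewrite mulrBr.
  rewrite sumrB -mulr_suml P1 mul1r.
  rewrite /loss (eq_bigr (fun a : draws n =>
    \sum_i P j i * J_mx R n i a.1 - J_mx R n j a.1)).
    rewrite sumrB exchange_big/=; congr (_ - _).
    by apply: eq_bigr => i _; rewrite mulr_sumr.
  move=> a _; rewrite /game_mx /residual_mx linearB/= trmxK trmx1 mulmxBl mul1mx.
  by rewrite !mxE.
have [j _ jmax] := arg_maxP u (erefl true : xpredT (Ordinal n0)).
exists j; rewrite lossE; apply: sumr_le0 => i _.
by rewrite mulr_ge0_le0// subr_le0; exact: jmax.
Qed.

End Game.

Section Potential.
Variables (R : realType) (n : nat) (P : 'M[R]_n) (gx gy : R).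

Definition is_prob_vector m (q : 'cV[R]_m) := is_dist (fun i => q i 0).

Definition mgf m (q : 'cV[R]_m) (x : 'I_m -> R) : R :=
  \sum_i q i 0 * expR (x i).

Lemma eq_mgf m (q : 'cV[R]_m) (x y : 'I_m -> R) : x =1 y -> mgf q x = mgf q y.
Proof. by move=> xy; apply: eq_bigr => i _; rewrite xy. Qed.

Lemma mgf0 m (q : 'cV[R]_m) (x : 'I_m -> R) : is_prob_vector q ->
  (forall i, x i = 0) -> mgf q x = 1.
Proof.
move=> qd x0; rewrite -qd.2; apply: eq_bigr => i _.
by rewrite x0 expR0 mulr1.
Qed.

Lemma mgf_gt0 m (q : 'cV[R]_m) (x : 'I_m -> R) : is_prob_vector q -> 0 < mgf q x.
Proof. exact: expR_mean_gt0. Qed.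

Lemma reweight_prob_vector (m : nat) (q : 'cV[R]_m) (x : 'I_m -> R) :
  is_prob_vector q -> is_prob_vector (normalize (\col_i (q i 0 * expR (x i)))).
Proof.
move=> qd; have Z0 := mgf_gt0 x qd; have [q0 q1] := qd.
have ZE : \sum_i (\col_k (q k 0 * expR (x k))) i 0 = \sum_i q i 0 * expR (x i).
  by apply: eq_bigr => i _; rewrite mxE.
split=> [i|]; rewrite /normalize.
  by rewrite ZE !mxE mulr_ge0 ?mulr_ge0 ?expR_ge0// invr_ge0 ltW.
under eq_bigr do rewrite mxE.
by rewrite -mulr_sumr mulVf// ZE gt_eqF.
Qed.

(** Why the potential is multiplicative: the normalized weights [q i * expR (x i)] are
    the next distribution, and the normalizing constant factors out. *)
Lemma reweight_mgf (m : nat) (q : 'cV[R]_m) (x y : 'I_m -> R) :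
  is_prob_vector q ->
  mgf q (fun i => x i + y i) =
    mgf q x * mgf (normalize (\col_i (q i 0 * expR (x i)))) y.
Proof.
move=> qd; have := mgf_gt0 x qd; rewrite /mgf => Z0.
rewrite /normalize mulr_sumr; apply: eq_bigr => i _.
rewrite !mxE [X in X^-1](eq_bigr (fun i => q i 0 * expR (x i))); last first.
  by move=> k _; rewrite mxE.
by rewrite expRD; field; rewrite gt_eqF.
Qed.

Lemma path_prob_ge0 (w : seq (draws n)) pi p :
  is_prob_vector pi -> is_prob_vector p -> 0 <= path_prob P gx gy pi p w.
Proof.
elim: w pi p => [//|[i j] w IH] pi p pid pd /=.
rewrite mulr_ge0//; first by rewrite mulr_ge0 ?pid.1 ?pd.1.
by apply: IH; exact: reweight_prob_vector.
Qed.

Lemma path_prob_total (k : nat) pi p :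
  is_prob_vector pi -> is_prob_vector p ->
  \sum_(w : k.-tuple (draws n)) path_prob P gx gy pi p w = 1.
Proof.
elim: k pi p => [|k IH] pi p pid pd; first by rewrite sum_tuple0.
rewrite sum_drawsS/=.
rewrite -pid.2; apply: eq_bigr => i _.
rewrite -[RHS]mulr1 -[X in _ = _ * X]pd.2 mulr_sumr; apply: eq_bigr => j _.
by rewrite -mulr_sumr IH ?mulr1//; exact: reweight_prob_vector.
Qed.

Variables (ty tx kap : R).

Definition potential (pi : 'cV[R]_(n + n)) (p : 'cV[R]_n) (w : seq (draws n)) : R :=
  mgf pi (fun i => gy * gain P w i) `^ ty *
  mgf p (fun j => - gx * loss P w j) `^ tx.

Hypothesis step : forall pi p, is_prob_vector pi -> is_prob_vector p ->
  \sum_i \sum_j pi i 0 * p j 0 * potential pi p [:: (i, j)] <= expR kap.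

Lemma potential_cons pi p i j w : is_prob_vector pi -> is_prob_vector p ->
  potential pi p ((i, j) :: w) =
  potential pi p [:: (i, j)] * potential (next_pi P gy pi j) (next_p P gx p i) w.
Proof.
move=> pid pd; rewrite /potential.
rewrite (@eq_mgf _ pi _ (fun i' => gy * game_mx P j i' + gy * gain P w i'));
  last by move=> i'; rewrite /gain big_cons mulrDr.
rewrite (@eq_mgf _ p _ (fun j' => - gx * game_mx P j' i + - gx * loss P w j'));
  last by move=> j'; rewrite /loss big_cons mulrDr.
rewrite (@eq_mgf _ pi (fun i' => gy * gain P [:: (i, j)] i')
    (fun i' => gy * game_mx P j i'));
  last by move=> i'; rewrite /gain big_seq1.
rewrite (@eq_mgf _ p (fun j' => - gx * loss P [:: (i, j)] j')
    (fun j' => - gx * game_mx P j' i));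
  last by move=> j'; rewrite /loss big_seq1.
rewrite !reweight_mgf// !powRM ?(ltW (mgf_gt0 _ _))//; first by rewrite mulrACA.
all: exact: reweight_prob_vector.
Qed.

Lemma potential_mean k pi p : is_prob_vector pi -> is_prob_vector p ->
  \sum_(w : k.-tuple (draws n)) path_prob P gx gy pi p w * potential pi p w
    <= expR (k%:R * kap).
Proof.
elim: k pi p => [|k IH] pi p pid pd.
  rewrite (sum_tuple0 (fun w => path_prob P gx gy pi p w * potential pi p w))/=.
  rewrite mul1r mul0r expR0 /potential !mgf0 ?powR1 ?mulr1//.
  - by move=> i; rewrite /loss big_nil mulr0.
  - by move=> i; rewrite /gain big_nil mulr0.
rewrite (sum_drawsS _ (fun w => path_prob P gx gy pi p w * potential pi p w))/=.
rewrite -natr1 mulrDl mul1r addrC expRD.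
apply: le_trans (ler_wpM2r (expR_ge0 _) (step pid pd)).
rewrite mulr_suml; apply: ler_sum => i _.
rewrite mulr_suml; apply: ler_sum => j _.
rewrite (eq_bigr (fun w : k.-tuple (draws n) =>
  pi i 0 * p j 0 * potential pi p [:: (i, j)] *
  (path_prob P gx gy (next_pi P gy pi j) (next_p P gx p i) w *
   potential (next_pi P gy pi j) (next_p P gx p i) w))); last first.
  by move=> w _; rewrite potential_cons// -[RHS]mulrACA.
rewrite -mulr_sumr ler_wpM2l//.
  by rewrite !mulr_ge0 ?pid.1 ?pd.1 ?powR_ge0.
by apply: IH; exact: reweight_prob_vector.
Qed.

End Potential.

(** * Probability of a large residual *)

Section Step.
Variables (R : realType) (n : nat) (P : 'M[R]_n) (gx gy l : R).
Hypotheses (tP : is_transition_matrix P) (gx0 : 0 < gx) (gy0 : 0 < gy) (l0 : 0 <= l).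
Variables (pi : 'cV[R]_(n + n)) (p : 'cV[R]_n).
Hypotheses (pid : is_prob_vector pi) (pd : is_prob_vector p).

Let Zy j := mgf pi (fun i => gy * game_mx P j i).
Let Zx i := mgf p (fun j => gx * - game_mx P j i).

(** Independence of the two draws of an iteration. *)
Lemma potential_step_factor :
  \sum_i \sum_j pi i 0 * p j 0 * potential P gx gy (l / gy) (l / gx) pi p [:: (i, j)] =
  (\sum_j p j 0 * Zy j `^ (l / gy)) * (\sum_i pi i 0 * Zx i `^ (l / gx)).
Proof.
rewrite [RHS]mulrC big_distrlr/=; apply: eq_bigr => i _; apply: eq_bigr => j _.
rewrite [RHS]mulrACA; congr (_ * _); rewrite /potential [RHS]mulrC.
rewrite (@eq_mgf _ _ pi _ (fun i' => gy * game_mx P j i'));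
  last by move=> i'; rewrite /gain big_seq1.
rewrite (@eq_mgf _ _ p _ (fun j' => gx * - game_mx P j' i));
  last by move=> j'; rewrite /loss big_seq1 mulNr mulrN.
by [].
Qed.

Let v := \sum_j p j 0 * \sum_i pi i 0 * game_mx P j i.

Lemma mean_payoff_swap : \sum_i pi i 0 * \sum_j p j 0 * - game_mx P j i = - v.
Proof.
rewrite /v -sumrN; under eq_bigr do rewrite mulr_sumr.
rewrite exchange_big/=; apply: eq_bigr => j _.
by rewrite -mulrN -sumrN mulr_sumr; apply: eq_bigr => i _; ring.
Qed.

Let Mb := game_mx_bound tP.
Let NMb i j : -1 <= - game_mx P j i <= 1.
Proof. by rewrite lerNl opprK lerNl andbC. Qed.

Let mgf_ge0 m (q : 'cV[R]_m) (Z : 'I_m -> R) t :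
  is_prob_vector q -> 0 <= \sum_i q i 0 * Z i `^ t.
Proof. by move=> qd; apply: sumr_ge0 => i _; rewrite mulr_ge0 ?qd.1 ?powR_ge0. Qed.

Lemma potential_step_small : l <= gx -> l <= gy ->
  \sum_i \sum_j pi i 0 * p j 0 * potential P gx gy (l / gy) (l / gx) pi p [:: (i, j)]
    <= expR (l * (gx + gy) / 2).
Proof.
move=> lx ly; rewrite potential_step_factor.
have := small_power_step pd pid Mb gy0 l0 ly.
have := small_power_step pid pd NMb gx0 l0 lx.
rewrite mean_payoff_swap -/v => hx hy.
apply: le_trans (ler_pM _ _ hy hx) _; rewrite ?mgf_ge0//.
by rewrite -expRD ler_expR le_eqVlt; apply/orP; left; apply/eqP; move: v => v'; field.
Qed.

Lemma potential_step_any :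
  \sum_i \sum_j pi i 0 * p j 0 * potential P gx gy (l / gy) (l / gx) pi p [:: (i, j)]
    <= expR (l * (gx + gy) / 2 + l ^+ 2).
Proof.
rewrite potential_step_factor.
have := any_power_step pd pid Mb gy0 l0.
have := any_power_step pid pd NMb gx0 l0.
rewrite mean_payoff_swap -/v => hx hy.
apply: le_trans (ler_pM _ _ hy hx) _; rewrite ?mgf_ge0//.
by rewrite -expRD ler_expR le_eqVlt; apply/orP; left; apply/eqP; move: v => v'; field.
Qed.

End Step.

Section Output.
Variables (R : realType) (n : nat) (P : 'M[R]_n).

Lemma residual_average (N : nat) (w : N.-tuple (draws n)) (i : 'I_n) :
  (residual_mx P *m (averages R w).1) i 0 = N%:R^-1 * gain P w (lshift n i).
Proof.
rewrite /averages/= -scalemxAr mxE; congr (_ * _).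
rewrite mulmx_sumr summxE /gain big_tuple; apply: eq_bigr => k _.
rewrite -colE mxE game_mxl /residual_mx !mxE.
by rewrite eq_sym.
Qed.

Lemma output_norm_le (N : nat) (w : N.-tuple (draws n)) (eps : R) :
  (0 < N)%N -> 0 <= eps -> (forall i, gain P w i <= N%:R * eps) ->
  `|residual_mx P *m (averages R w).1| <= eps.
Proof.
move=> N0 e0 gw; rewrite [`|_|]mx_normrE; apply: bigmax_le => // -[i k] _ /=.
have N0' : (0 : R) < N%:R by rewrite ltr0n.
rewrite (ord1 k) residual_average normrM gtr0_norm ?invr_gt0// ler_pdivrMl//.
rewrite ler_norml gw andbT.
have := gw (rshift n i); suff -> : gain P w (rshift n i) = - gain P w (lshift n i).
  by rewrite lerNl.
by rewrite /gain -sumrN; apply: eq_bigr => a _; rewrite game_mxl game_mxr.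
Qed.

End Output.

Section Failure.
Variables (R : realType) (n N : nat) (P : 'M[R]_n) (gx gy l kap eps : R).
Hypotheses (tP : is_transition_matrix P) (n0 : (0 < n)%N) (N0 : (0 < N)%N).
Hypotheses (gx0 : 0 < gx) (gy0 : 0 < gy) (l0 : 0 <= l) (eps0 : 0 <= eps).

Lemma uniform_prob_vector m : (0 < m)%N ->
  is_prob_vector (const_mx m%:R^-1 : 'cV[R]_m).
Proof.
move=> m0; split=> [i|]; first by rewrite mxE invr_ge0 ler0n.
under eq_bigr do rewrite mxE.
by rewrite sumr_const card_ord -[X in X *+ _]mulr1 -mulrnAr mulVf// pnatr_eq0 -lt0n.
Qed.

(** Keeping the single term [i] of the mean costs the factor [m], that is, [ln m] in
    the exponent. *)
Lemma uniform_mgf_ge m (x : 'I_m -> R) (i : 'I_m) (y : R) : (0 < m)%N -> y <= x i ->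
  expR (y - ln m%:R) <= mgf (const_mx m%:R^-1) x.
Proof.
move=> m0 yx; rewrite /mgf (bigD1 i)//= expRD expRN lnK ?posrE ?ltr0n// mxE mulrC.
apply: (@le_trans _ _ (m%:R^-1 * expR (x i))).
  by rewrite ler_wpM2l ?invr_ge0 ?ler0n// ler_expR.
rewrite lerDl; apply: sumr_ge0 => k _.
by rewrite mxE mulr_ge0 ?expR_ge0// invr_ge0.
Qed.

Let pi1 : 'cV[R]_(n + n) := const_mx (n + n)%:R^-1.
Let p1 : 'cV[R]_n := const_mx n%:R^-1.

(** The gain [t] bounds the factor of the maximizing player from below; for the other
    factor a coordinate with nonpositive loss suffices. *)
Lemma bad_potential_ge (w : seq (draws n)) (i : 'I_(n + n)) (t : R) :
  t <= gain P w i ->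
  expR (l * t - l / gy * ln (n + n)%:R - l / gx * ln n%:R) <=
    potential P gx gy (l / gy) (l / gx) pi1 p1 w.
Proof.
move=> ti; have [j lj] := loss_le0 tP w n0.
have n20 : (0 < n + n)%N by rewrite addn_gt0 n0.
have -> : l * t - l / gy * ln (n + n)%:R - l / gx * ln n%:R =
   (gy * t - ln (n + n)%:R) * (l / gy) + (0 - ln n%:R) * (l / gx).
  by field; rewrite !lt0r_neq0.
rewrite expRD !expRM; apply: ler_pM; rewrite ?powR_ge0//.
- apply: ge0_ler_powR; rewrite ?nnegrE ?expR_ge0//.
  + by rewrite divr_ge0// ltW.
  + by rewrite ltW// mgf_gt0//; exact: uniform_prob_vector.
  + by apply: (@uniform_mgf_ge _ (fun i => gy * gain P w i) i); rewrite // ler_wpM2l// ltW.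
- apply: ge0_ler_powR; rewrite ?nnegrE ?expR_ge0//.
  + by rewrite divr_ge0// ltW.
  + by rewrite ltW// mgf_gt0//; exact: uniform_prob_vector.
  + apply: (@uniform_mgf_ge _ (fun j => - gx * loss P w j) j); rewrite //.
    by rewrite mulNr oppr_ge0 mulr_ge0_le0// ltW.
Qed.

Hypothesis step : forall pi p, is_prob_vector pi -> is_prob_vector p ->
  \sum_i \sum_j pi i 0 * p j 0 * potential P gx gy (l / gy) (l / gx) pi p [:: (i, j)]
    <= expR kap.

(** The Markov inequality for the potential. *)
Lemma GK_success_ge :
  1 - expR (N%:R * kap - l * (N%:R * eps) + l / gy * ln (n + n)%:R + l / gx * ln n%:R)
    <= GK_prob P gx gy N (fun out => `|residual_mx P *m out.1| <= eps).
Proof.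
have n20 : (0 < n + n)%N by rewrite addn_gt0 n0.
have pid := uniform_prob_vector n20; have pd := uniform_prob_vector n0.
rewrite lerBlDr -[leLHS](path_prob_total P gx gy N pid pd).
rewrite [leLHS](bigID (fun w => `|residual_mx P *m (averages R w).1| <= eps))/=.
rewrite lerD2l.
set B := l * (N%:R * eps) - l / gy * ln (n + n)%:R - l / gx * ln n%:R.
have -> : N%:R * kap - l * (N%:R * eps) + l / gy * ln (n + n)%:R + l / gx * ln n%:R
  = N%:R * kap - B by rewrite /B; ring.
rewrite expRD expRN ler_pdivlMr ?expR_gt0//.
apply: le_trans (potential_mean (ty := l / gy) (tx := l / gx) step N pid pd).
rewrite mulr_suml [leRHS](bigID (fun w : N.-tuple (draws n) =>
  `|residual_mx P *m (averages R w).1| <= eps))/=.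
apply: ler_wpDl.
  by apply: sumr_ge0 => w _; rewrite mulr_ge0 ?path_prob_ge0 ?mulr_ge0 ?powR_ge0.
apply: ler_sum => w bad; rewrite ler_wpM2l ?path_prob_ge0//.
have /existsP[i gi] : [exists i, N%:R * eps <= gain P w i].
  apply: contraNT bad; rewrite negb_exists => /forallP gw.
  apply: output_norm_le => // i; apply: ltW; rewrite ltNge; exact: gw.
exact: bad_potential_ge gi.
Qed.

End Failure.

(** Here [t] stands for [ln (1 / delta) / N], while [gx ^+ 2 / 2] and [gy ^+ 2 / 2] are
    the logarithms of the two dimensions divided by [N]; so the last hypothesis is
    the lower bound on [N]. The two conclusions are what the choices [l = gx] and
    [l = sqrt t] require. *)
Lemma step_size_tuning (R : realType) (gx gy t eps : R) :
  0 < gx -> 0 < gy -> gy <= 2 * gx -> 0 <= t -> 0 < eps ->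
  2 * gx ^+ 2 + 2 * gy ^+ 2 + 64 * t <= eps ^+ 2 ->
  (t <= gx ^+ 2 -> gx * (gx + gy) + t <= gx * eps) /\
  (gx ^+ 2 <= t -> 2 * t + Num.sqrt t * (gx + gy) <= Num.sqrt t * eps).
Proof.
move=> gx0 gy0 gyx t0 e0 h; split => tg.
  suff : gx + gy + t / gx <= eps.
    rewrite -(ler_pM2l gx0) [gx * (_ + _ + _)]mulrDr mulrCA divff ?mulr1//.
    exact: lt0r_neq0.
  have st0 : 0 <= t / gx by rewrite divr_ge0// ltW.
  have sE : t = t / gx * gx by field; exact: lt0r_neq0.
  move: (t / gx) st0 sE => s s0 sE; subst t.
  have sgx : s <= gx by rewrite -(ler_pM2r gx0) -expr2.
  rewrite -ler_sqr ?nnegrE ?(ltW e0) ?addr_ge0 ?(ltW gx0) ?(ltW gy0)//.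
  apply: le_trans h.
  have h1 : s * gy <= s * (2 * gx) by rewrite ler_wpM2l.
  have h2 : s * s <= s * gx by rewrite ler_wpM2l.
  have := sqr_ge0 (gx - gy); have := mulr_ge0 s0 (ltW gx0); nra.
have st0 : 0 <= Num.sqrt t by exact: sqrtr_ge0.
have sE : t = Num.sqrt t ^+ 2 by rewrite sqr_sqrtr.
move: (Num.sqrt t) st0 sE => s s0 sE; subst t.
have sgx : gx <= s by rewrite -(ler_pXn2r (n := 2)) ?nnegrE ?(ltW gx0).
suff : 2 * s + (gx + gy) <= eps.
  by move=> /(ler_wpM2l s0); rewrite mulrDr; apply: le_trans; rewrite lerD2r; nra.
rewrite -ler_sqr ?nnegrE ?(ltW e0) ?addr_ge0 ?mulr_ge0 ?(ltW gx0) ?(ltW gy0)//.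
apply: le_trans h.
have h1 : s * gy <= s * (2 * gx) by rewrite ler_wpM2l.
have h2 : s * gx <= s * s by rewrite ler_wpM2l.
have := sqr_ge0 (gx - gy); nra.
Qed.

Lemma iteration_count_gt0 (R : realType) (n N : nat) (eps delta : R) :
  (0 < n)%N -> 0 < eps -> 0 < delta -> delta < 1 ->
  4 * eps ^- 2 * (ln (2 * n)%:R + ln n%:R + 16 * ln (1 / delta)) <= N%:R ->
  (0 < N)%N.
Proof.
move=> n0 e0 d0 d1 h; rewrite -(ltr_nat R); apply: lt_le_trans h.
have c0 : 0 < ln (1 / delta) by rewrite ln_gt0// ltr_pdivlMr// mul1r.
have b0 : 0 <= ln n%:R :> R by rewrite ln_ge0// ler1n.
have a0 : 0 <= ln (2 * n)%:R :> R by rewrite ln_ge0// ler1n muln_gt0.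
rewrite !mulr_gt0 ?invr_gt0 ?exprn_gt0//; lra.
Qed.

(** For [n = 1] the residual matrix is 0, and [gx = 0]; otherwise [step_size_tuning]
    justifies the parameter [l] of the potential in each of the two regimes for
    [delta]. *)
Lemma GK_accuracy (R : realType) (n : nat) (P : 'M[R]_n) (eps delta : R) (N : nat) :
  (0 < n)%N -> is_transition_matrix P -> 0 < eps -> 0 < delta -> delta < 1 ->
  4 * eps ^- 2 * (ln (2 * n)%:R + ln n%:R + 16 * ln (1 / delta)) <= N%:R ->
  1 - delta <= GK_prob P (Num.sqrt (2 * ln n%:R / N%:R))
     (Num.sqrt (2 * ln (2 * n)%:R / N%:R)) N
     (fun out => `|residual_mx P *m out.1| <= eps).
Proof.
move=> n0 tP e0 d0 d1 hN; have N0 := iteration_count_gt0 n0 e0 d0 d1 hN.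
have N0' : (0 : R) < N%:R by rewrite ltr0n.
case: (leqP n 1) => [n1|n1].
  have nE : n = 1%N by apply/eqP; rewrite eqn_leq n1.
  subst n; have A0 : residual_mx P = 0.
    apply/matrixP => i j; rewrite !mxE !ord1 eqxx mulr1n.
    by have [_ /(_ 0)] := tP; rewrite big_ord1 => ->; rewrite subrr.
  rewrite /GK_prob (eq_bigl xpredT) => [|w]; last by rewrite A0 mul0mx normr0 ltW.
  rewrite path_prob_total ?lerBlDr ?lerDl ?(ltW d0)//; exact: uniform_prob_vector.
set a := ln (2 * n)%:R in hN *; set b := ln n%:R in hN *.
set gx := Num.sqrt _; set gy := Num.sqrt _.
set c := ln (1 / delta) in hN.
have c0 : 0 < c by rewrite ln_gt0// ltr_pdivlMr// mul1r.
have b0 : 0 < b by rewrite ln_gt0// ltr1n.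
have ab : a = ln 2 + b by rewrite /a natrM lnM ?posrE ?ltr0n.
have l2 : 0 < ln 2 :> R by rewrite ln_gt0// ltr1n.
have l2b : ln 2 <= b by rewrite ler_ln ?posrE ?ltr0n// ler_nat.
have gx0 : 0 < gx by rewrite sqrtr_gt0 divr_gt0// mulr_gt0.
have gy0 : 0 < gy by rewrite sqrtr_gt0 divr_gt0// mulr_gt0// ab addr_gt0.
have gx2 : gx ^+ 2 = 2 * b / N%:R by rewrite sqr_sqrtr// divr_ge0// mulr_ge0// ltW.
have gy2 : gy ^+ 2 = 2 * a / N%:R.
  by rewrite sqr_sqrtr// divr_ge0// mulr_ge0// ab addr_ge0// ltW.
have bE : b = N%:R * gx ^+ 2 / 2 by rewrite gx2; field; exact: lt0r_neq0.
have aE : a = N%:R * gy ^+ 2 / 2 by rewrite gy2; field; exact: lt0r_neq0.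
pose t := c / N%:R; have cE : c = N%:R * t by rewrite /t; field; exact: lt0r_neq0.
have t0 : 0 <= t by rewrite divr_ge0// ltW.
have gyx : gy <= 2 * gx.
  rewrite -ler_sqr ?nnegrE ?mulr_ge0 ?(ltW gx0) ?(ltW gy0)// exprMn gx2 gy2.
  by rewrite mulrA ler_pM2r ?invr_gt0//; lra.
have hE : 2 * gx ^+ 2 + 2 * gy ^+ 2 + 64 * t <= eps ^+ 2.
  rewrite -(ler_pM2l N0'); move: hN.
  rewrite mulrAC ler_pdivrMr ?exprn_gt0// aE bE cE; lra.
have [small large] := step_size_tuning gx0 gy0 gyx t0 e0 hE.
have deltaE : delta = expR (- c).
  by rewrite expRN /c lnK ?posrE ?divr_gt0// div1r invrK.
(* The initial weights contribute [l / gy * a + l / gx * b], that is,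
   [N * l * (gx + gy) / 2] for the step-sizes of the algorithm. *)
have fin l kap : 0 < l -> kap + l * (gx + gy) / 2 + t <= l * eps ->
    N%:R * kap - l * (N%:R * eps) + l / gy * ln (n + n)%:R + l / gx * ln n%:R <= - c.
  move=> l0 h; rewrite addnn -mul2n -/a -/b aE bE cE.
  have -> : l / gy * (N%:R * gy ^+ 2 / 2) = N%:R * (l * gy / 2).
    by field; exact: lt0r_neq0.
  have -> : l / gx * (N%:R * gx ^+ 2 / 2) = N%:R * (l * gx / 2).
    by field; exact: lt0r_neq0.
  move: h; rewrite -(ler_pM2l N0'); lra.
rewrite deltaE; case: (leP t (gx ^+ 2)) => tg.
  apply: le_trans (GK_success_ge tP n0 N0 gx0 gy0 (ltW gx0) (ltW e0)
    (kap := gx * (gx + gy) / 2) _).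
    rewrite lerD2l lerN2 ler_expR; apply: fin => //.
    by have := small tg; lra.
  move=> pi p pid pd; apply: potential_step_small => //; first exact: ltW.
  rewrite -ler_sqr ?nnegrE ?(ltW gx0) ?(ltW gy0)// gx2 gy2.
  by rewrite ler_pM2r ?invr_gt0//; lra.
have sq0 : 0 < Num.sqrt t by rewrite sqrtr_gt0 (lt_trans _ tg)// exprn_gt0.
apply: le_trans (GK_success_ge tP n0 N0 gx0 gy0 (ltW sq0) (ltW e0)
  (kap := Num.sqrt t * (gx + gy) / 2 + Num.sqrt t ^+ 2) _).
  rewrite lerD2l lerN2 ler_expR; apply: fin => //.
  by have := large (ltW tg); rewrite sqr_sqrtr//; lra.
move=> pi p pid pd; apply: potential_step_any => //; exact: ltW.
Qed.

(** * Mean value and cost of programs *)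

Section Semantics.
Variable R : realType.

Fixpoint mean (T : Type) (F : T -> R) (c : prog R T) : R :=
  match c with
  | Ret a => F a
  | Op o k => mean F (k (arith_eval o))
  | Step c' => mean F c'
  | Flip w k => w * mean F (k true) + (1 - w) * mean F (k false)
  end.

(** The worst-case number of steps when the continuation needs [K a] more steps after
    the result [a]; unlike [run_time] it composes along [bind] ([cost_bind]). *)
Fixpoint cost (T : Type) (K : T -> nat) (c : prog R T) : nat :=
  match c with
  | Ret a => K a
  | Op o k => (cost K (k (arith_eval o))).+1
  | Step c' => (cost K c').+1
  | Flip _ k => (maxn (cost K (k true)) (cost K (k false))).+1
  end.

(** A total-correctness triple for programs without random choices, with a budget of
    [t] steps. *)
Fixpoint terminates (T : Type) (c : prog R T) (t : nat) (Q : T -> Prop) : Prop :=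
  match c with
  | Ret a => Q a
  | Op o k => if t is t'.+1 then terminates (k (arith_eval o)) t' Q else False
  | Step c' => if t is t'.+1 then terminates c' t' Q else False
  | Flip _ _ => False
  end.

Lemma prog_prob_mean (T : Type) (E : pred T) (c : prog R T) :
  prog_prob E c = mean (fun a => (E a)%:R) c.
Proof. by elim: c => //= w k IH; rewrite !IH. Qed.

Lemma run_time_cost (T : Type) (c : prog R T) : run_time c = cost (fun=> 0%N) c.
Proof. by elim: c => [a|o k IH|c IH|w k IH] /=; rewrite ?IH. Qed.

Lemma mean_bind (S T : Type) (F : T -> R) (c : prog R S) (f : S -> prog R T) :
  mean F (bind c f) = mean (fun a => mean F (f a)) c.
Proof. by elim: c => //= w k IH; rewrite !IH. Qed.

Lemma cost_bind (S T : Type) (K : T -> nat) (c : prog R S) (f : S -> prog R T) :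
  cost K (bind c f) = cost (fun a => cost K (f a)) c.
Proof. by elim: c => [a|o k IH|c IH|w k IH] /=; rewrite ?IH. Qed.

Lemma eq_mean (T : Type) (F G : T -> R) (c : prog R T) : F =1 G -> mean F c = mean G c.
Proof. by move=> FG; elim: c => //= w k IH; rewrite !IH. Qed.

Lemma leq_cost (T : Type) (K L : T -> nat) (c : prog R T) :
  (forall a, (K a <= L a)%N) -> (cost K c <= cost L c)%N.
Proof.
by move=> KL; elim: c => [a|o k IH|c IH|w k IH] //=; rewrite ltnS// geq_max !leq_max !IH orbT.
Qed.

Lemma terminatesW (T : Type) (c : prog R T) (t u : nat) (Q : T -> Prop) :
  terminates c t Q -> (t <= u)%N -> terminates c u Q.
Proof.
by elim: c t u => [a|o k IH|c IH|w k IH] [|t] [|u] //= h tu; exact: IH h tu.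
Qed.

Lemma terminates_imp (T : Type) (c : prog R T) (t : nat) (Q Q' : T -> Prop) :
  (forall a, Q a -> Q' a) -> terminates c t Q -> terminates c t Q'.
Proof.
move=> QQ'; elim: c t => [a|o k IH|c IH|w k IH] [|t] //=; first exact: QQ'.
- exact: QQ'.
- exact: IH.
- exact: IH.
Qed.

Lemma terminates_bind (S T : Type) (c : prog R S) (f : S -> prog R T)
    (t u : nat) (Q : S -> Prop) (Q' : T -> Prop) :
  terminates c t Q -> (forall a, Q a -> terminates (f a) u Q') ->
  terminates (bind c f) (t + u) Q'.
Proof.
elim: c t => [a|o k IH|c IH|w k IH] [|t]//= h fQ.
- exact: fQ.
- by apply: terminatesW (fQ _ h) _; rewrite leq_addl.
- exact: IH h fQ.
- exact: IH h fQ.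
Qed.

Lemma terminates_run (T : Type) (c : prog R T) (t : nat) (Q : T -> Prop) :
  terminates c t Q -> exists a, [/\ Q a, forall F, mean F c = F a &
    forall K, (cost K c <= t + K a)%N].
Proof.
elim: c t => [a|o k IH|c IH|w k IH] t //=.
- by move=> Qa; exists a; split=> // K; rewrite leq_addl.
- case: t => // t /IH[a [Qa Fa Ka]]; exists a.
  by split=> // K; exact: Ka.
- by case: t.
Qed.

End Semantics.

Section Trees.
Variable R : realType.

(** The weights of the leaves are [q 0], ..., [q (m - 1)] and every internal node
    carries a correct sum. Shape and splitting follow the arithmetic by which the
    programs navigate, so the height is at most [up_log 2 m]. *)
Fixpoint represents (m : nat) (q : nat -> R) (t : wtree R) : Prop :=
  match t with
  | Leaf w => m = 1%N /\ w = q 0%N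
  | Node w l r => [/\ (1 < m)%N, w = \sum_(k < m) q k, represents m./2 q l &
      represents (m - m./2) (fun k => q (m./2 + k)%N) r]
  end.

Lemma eq_represents (m : nat) (q q' : nat -> R) (t : wtree R) :
  (forall i, (i < m)%N -> q i = q' i) -> represents m q t -> represents m q' t.
Proof.
elim: t m q q' => [w|w l IHl r IHr] m q q' qq' /=.
  by move=> [m1 ->]; split=> //; apply: qq'; rewrite m1.
move=> [m1 -> hl hr]; split=> //.
- by apply: eq_bigr => i _; exact: qq'.
- by apply: IHl hl => i im; apply: qq'; lia.
- by apply: IHr hr => i im; apply: qq'; lia.
Qed.

Lemma weight_represents (m : nat) (q : nat -> R) (t : wtree R) :
  represents m q t -> weight t = \sum_(k < m) q k.
Proof. by case: t => [w [-> ->]|w l r []//]; rewrite big_ord1. Qed.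

Lemma sum_ord_split (h m : nat) (q : nat -> R) : (h <= m)%N ->
  \sum_(k < m) q k = \sum_(k < h) q k + \sum_(k < m - h) q (h + k)%N.
Proof.
move=> hm; have -> : \sum_(k < m) q k = \sum_(k < h + (m - h)) q k by rewrite subnKC.
by rewrite big_split_ord.
Qed.

(** The right subtree is at least as large as the left one, so this is the recursion
    for the height. *)
Lemma up_log2_half (m : nat) : (1 < m)%N ->
  up_log 2 m = (up_log 2 (m - m./2)).+1.
Proof.
case: m => [|[|m]]// _; rewrite up_log2S//; congr (up_log 2 _).+1.
lia.
Qed.

Lemma up_log2_half_le (m : nat) : (1 < m)%N -> (up_log 2 m./2 < up_log 2 m)%N.
Proof. by move=> m1; rewrite (up_log2_half m1) ltnS leq_up_log//; lia. Qed.

Lemma build_tree_spec (h m : nat) (w : R) : (0 < m)%N -> (m <= h)%N ->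
  terminates (build_tree h m w) (3 * m - 2) (represents m (fun=> w)).
Proof.
elim: h m => [|h IH] m m0 mh; first by lia.
rewrite [build_tree _ _ _]/=; case: leqP => m1.
  have -> : m = 1%N by lia.
  by [].
have IHl : terminates (build_tree h m./2 w) (3 * m./2 - 2) (represents m./2 (fun=> w)).
  by apply: IH; lia.
have IHr : terminates (build_tree h (m - m./2) w) (3 * (m - m./2) - 2)
    (represents (m - m./2) (fun=> w)) by apply: IH; lia.
apply: (@terminatesW _ _ _ ((3 * m./2 - 2) + ((3 * (m - m./2) - 2) + 1)).+1); last lia.
apply: (terminates_bind IHl) => l hl; apply: (terminates_bind IHr) => r hr /=.
split=> //; rewrite (weight_represents hl) (weight_represents hr).
by rewrite [RHS](@sum_ord_split m./2)//; lia.
Qed.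

Lemma scale_leaf_spec (m : nat) (q : nat -> R) (t : wtree R) (i : nat) (c : R) :
  (i < m)%N -> represents m q t ->
  terminates (scale_leaf m t i c) (2 * (up_log 2 m).+1)
    (represents m (fun k => if k == i then q k * c else q k)).
Proof.
elim: t m q i => [w|w l IHl r IHr] m q i im.
  move=> [m1 ->]; rewrite m1 in im *; rewrite up_log1/=; split=> //.
  by have -> : i = 0%N by lia.
rewrite [scale_leaf _ _ _ _]/=; move=> [m1 _ hl hr]; have hm : (m./2 <= m)%N by lia.
have lm := up_log2_half_le m1; have rm := up_log2_half m1.
case: ltnP => ih.
  apply: (@terminatesW _ _ _ (2 * (up_log 2 m./2).+1 + 1).+1); last lia.
  apply: (terminates_bind (IHl _ _ _ ih hl)) => l' hl' /=.
  have hr' : represents (m - m./2) (fun k => if (m./2 + k)%N == i then q (m./2 + k)%N * c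
      else q (m./2 + k)%N) r.
    by apply: eq_represents hr => k km; case: eqP => //; lia.
  split=> //.
  by rewrite (weight_represents hl') (weight_represents hr') 
  [RHS](sum_ord_split (fun k => if k == i then q k * c else q k) hm).
apply: (@terminatesW _ _ _ (2 * (up_log 2 (m - m./2)).+1 + 1).+1); last lia.
have ir : (i - m./2 < m - m./2)%N by lia.
apply: (terminates_bind (IHr _ _ _ ir hr)) => r' hr' /=.
have hl' : represents m./2 (fun k => if k == i then q k * c else q k) l.
  by apply: eq_represents hl => k km; case: eqP => //; lia.
have hr2 : represents (m - m./2) (fun k => if (m./2 + k)%N == i then q (m./2 + k)%N * c
      else q (m./2 + k)%N) r'.
  apply: eq_represents hr' => k km; have -> : (k == i - m./2)%N = (m./2 + k == i)%N by lia.
  by [].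
split=> //.
by rewrite (weight_represents hl') (weight_represents hr2) 
  [RHS](sum_ord_split (fun k => if k == i then q k * c else q k) hm).
Qed.

Lemma sum_gt0 (m : nat) (q : nat -> R) : (0 < m)%N -> (forall i, 0 < q i) ->
  0 < \sum_(k < m) q k.
Proof.
move=> m0 q0; rewrite -(prednK m0) big_ord_recl ltr_pwDl//.
by apply: sumr_ge0 => i _; exact: ltW.
Qed.

(** Along the descent the conditional probabilities telescope to the share of the leaf
    in the total weight. *)
Lemma sample_leaf_mean (m : nat) (q : nat -> R) (t : wtree R) (F : nat -> R) :
  (forall i, 0 < q i) -> represents m q t ->
  mean F (sample_leaf m t) = \sum_(i < m) (\sum_(k < m) q k)^-1 * q i * F i.
Proof.
elim: t m q F => [w|w l IHl r IHr] m q F q0.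
  by move=> [-> ->]; rewrite /= !big_ord1 mulVf ?mul1r// gt_eqF.
move=> [m1 -> hl hr]; have hm : (m./2 <= m)%N by lia.
rewrite [sample_leaf _ _]/= [LHS]/= (IHl _ _ _ q0 hl) mean_bind.
rewrite (IHr _ _ _ (fun k => q0 (m./2 + k)%N) hr)/= (weight_represents hl).
rewrite [in RHS](sum_ord_split (fun i => (\sum_(k < m) q k)^-1 * q i * F i) hm).
have sl : 0 < \sum_(k < m./2) q k by apply: sum_gt0 => //; lia.
have sr : 0 < \sum_(k < m - m./2) q (m./2 + k)%N.
  by apply: (@sum_gt0 _ (fun k => q (m./2 + k)%N)) => //; lia.
rewrite (sum_ord_split q hm).
set sL := \sum_(k < m./2) q k in sl *.
set sR := \sum_(k < m - m./2) q (m./2 + k)%N in sr *.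
have sLR : sL + sR != 0 by rewrite gt_eqF ?addr_gt0.
rewrite !mulr_sumr; congr (_ + _); apply: eq_bigr => i _.
  by field; rewrite sLR gt_eqF.
by field; rewrite sLR gt_eqF.
Qed.

Lemma sample_leaf_cost (m : nat) (q : nat -> R) (t : wtree R) (K : nat -> nat) (B : nat) :
  represents m q t -> (forall i, (i < m)%N -> (K i <= B)%N) ->
  (cost K (sample_leaf m t) <= 3 * up_log 2 m + 1 + B)%N.
Proof.
elim: t m q K => [w|w l IHl r IHr] m q K.
  by move=> [-> _] /(_ 0%N isT) /=; lia.
move=> [m1 _ hl hr] KB; have lm := up_log2_half_le m1; have rm := up_log2_half m1.
rewrite [sample_leaf _ _]/= [cost _ _]/= cost_bind.
have := IHl _ _ _ hl (fun i im => KB i ltac:(lia)).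
have := IHr _ _ (fun i => K (m./2 + i)%N) hr (fun i im => KB (m./2 + i)%N ltac:(lia)).
rewrite /=.
lia.
Qed.

End Trees.

(** * Arrays and sparse vectors *)

Section Arrays.
Variable R : realType.

Lemma fill_spec (m : nat) (v : R) : terminates (fill m v) m (eq (nseq m v)).
Proof.
elim: m => [//|m IH]; rewrite [fill _ _]/=.
apply: (@terminatesW _ _ _ (m + 0).+1); last by rewrite addn0.
by rewrite /=; apply: (terminates_bind IH) => s <-.
Qed.

Definition incr (s : seq R) (i : nat) : seq R := set_nth 0 s i (nth 0 s i + 1).

Lemma divide_cells_spec (s : seq R) (c : R) :
  terminates (divide_cells s c) (2 * size s) (eq [seq v / c | v <- s]).
Proof.
elim: s => [//|v s IH]; rewrite [divide_cells _ _]/=.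
apply: (@terminatesW _ _ _ (2 * size s + 0).+2); last by rewrite addn0/=; lia.
by rewrite /=; apply: (terminates_bind IH) => s' <-.
Qed.

Lemma step_size_spec (m N : nat) :
  terminates (step_size R m N) 4 (eq (Num.sqrt (2 * ln m%:R / N%:R))).
Proof. by []. Qed.

Lemma foldl_incr_size (T : Type) (f : T -> nat) (w : seq T) (s : seq R) :
  (forall a, (f a < size s)%N) ->
  size (foldl (fun s a => incr s (f a)) s w) = size s.
Proof.
elim: w s => [//|a w IH] s fs /=.
have E : size (incr s (f a)) = size s by rewrite size_set_nth; apply/maxn_idPr.
by rewrite IH E.
Qed.

Lemma nth_foldl_incr (T : Type) (f : T -> nat) (w : seq T) (s : seq R) (i : nat) :
  nth 0 (foldl (fun s a => incr s (f a)) s w) i =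
  nth 0 s i + \sum_(a <- w) (f a == i)%:R.
Proof.
elim: w s => [|a w IH] s /=; first by rewrite big_nil addr0.
rewrite IH big_cons nth_set_nth/= addrA eq_sym; case: eqP => [->//|_].
by rewrite addr0.
Qed.

End Arrays.

Section SparseVectors.
Variable R : realType.
Implicit Types (s : svec R) (i c : nat).

(** Repeated indices are summed, as this is the effect of repeated multiplicative
    updates of a leaf. *)
Definition entry s i : R := \sum_(x <- s | x.1 == i) x.2.

Lemma entry_cons a s i : entry (a :: s) i = (if a.1 == i then a.2 else 0) + entry s i.
Proof. by rewrite /entry big_cons; case: ifP => _; rewrite ?add0r. Qed.

Definition indices_below (m : nat) s := all (fun x : nat * R => x.1 < m)%N s.

Lemma sub_unit_spec (m c : nat) s : (c < m)%N -> indices_below m s ->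
  terminates (sub_unit c s) (size s).+1 (fun s' =>
    [/\ (size s' <= (size s).+1)%N, indices_below m s' &
        forall i, entry s' i = entry s i - (c == i)%:R]).
Proof.
move=> cm; elim: s => [_|[j a] s IH].
  rewrite /=; split=> //=; first by rewrite /indices_below/= cm.
  by move=> i; rewrite entry_cons /entry !big_nil/= addr0 sub0r; case: eqP; rewrite ?oppr0.
rewrite /indices_below/= => /andP[jm sm]; case: eqP => [->/=|jc].
  split=> //=; first by rewrite cm.
  by move=> i; rewrite !entry_cons/=; case: eqP => _ /=; ring.
apply: (@terminatesW _ _ _ ((size s).+1 + 0)); last by rewrite addn0.
apply: (terminates_bind (IH sm)) => s' /= [h1 h2 h3].
split=> //=; first by rewrite jm.
by move=> i; rewrite !entry_cons/= h3 addrA.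
Qed.

Lemma update_p_spec (n : nat) (g : R) s (q : nat -> R) (t : wtree R) :
  indices_below n s -> represents n q t ->
  terminates (update_p n g s t) (size s * (2 * up_log 2 n + 5) + 1)
    (represents n (fun j => q j * expR (g * entry s j))).
Proof.
elim: s q t => [|[j a] s IH] q t.
  move=> _ qt /=; apply: eq_represents qt => i _.
  by rewrite /entry big_nil mulr0 expR0 mulr1.
move=> /andP[jn sn] qt; rewrite [is_true _]/= in jn.
rewrite [update_p _ _ _ _]/=.
apply: (@terminatesW _ _ _
  (2 * (up_log 2 n).+1 + (size s * (2 * up_log 2 n + 5) + 1)).+3);
  last by rewrite [size (_ :: _)]/= mulSn; lia.
rewrite /=; apply: (terminates_bind (scale_leaf_spec _ jn qt)) => t1 qt1.
have := IH _ _ sn qt1; apply: terminates_imp => t2.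
apply: eq_represents => i _; rewrite entry_cons/= mulrDr expRD eq_sym mulrA.
by case: eqP => [//|_]; rewrite mulr0 expR0 mulr1.
Qed.

(** An entry of a row of [A^T J], when [s] is the corresponding row of [A^T]. *)
Definition signed_entry (n : nat) s (i : nat) : R :=
  if (i < n)%N then entry s i else - entry s (i - n).

Lemma update_pi_spec (n : nat) (g : R) s (q : nat -> R) (t : wtree R) :
  indices_below n s -> represents (n + n) q t ->
  terminates (update_pi n g s t) (size s * (4 * up_log 2 (n + n) + 9) + 1)
    (represents (n + n) (fun i => q i * expR (g * signed_entry n s i))).
Proof.
elim: s q t => [|[j a] s IH] q t.
  move=> _ qt /=; apply: eq_represents qt => i _.
  by rewrite /signed_entry /entry !big_nil oppr0 if_same mulr0 expR0 mulr1.
move=> /andP[jn sn] qt; rewrite [is_true _]/= in jn.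
rewrite [update_pi _ _ _ _]/=.
have jn1 : (j < n + n)%N by lia.
have jn2 : (n + j < n + n)%N by lia.
apply: (@terminatesW _ _ _
  (2 * (up_log 2 (n + n)).+1 + (2 * (up_log 2 (n + n)).+1 +
   (size s * (4 * up_log 2 (n + n) + 9) + 1)).+2).+3);
  last by rewrite [size (_ :: _)]/= mulSn; lia.
rewrite /=; apply: (terminates_bind (scale_leaf_spec _ jn1 qt)) => t1 qt1.
rewrite /=; apply: (terminates_bind (scale_leaf_spec _ jn2 qt1)) => t2 qt2.
have := IH _ _ sn qt2; apply: terminates_imp => t3.
apply: eq_represents => i im; rewrite /signed_entry !entry_cons/=.
case: ltnP => iN.
  have -> : (i == n + j)%N = false by lia.
  rewrite mulrDr expRD eq_sym mulrA.
  by case: eqP => [//|_]; rewrite mulr0 expR0 mulr1.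
have -> : (i == j)%N = false by lia.
have -> : (j == i - n)%N = (i == n + j)%N by lia.
rewrite sub0r [in RHS]opprD [in RHS]mulrDr [in RHS]expRD mulrA.
case: eqP => _; first by rewrite (mulrN g a).
by rewrite oppr0 mulr0 expR0 mulr1.
Qed.

End SparseVectors.

Section SparseMatrix.
Variables (R : realType) (n : nat) (P : 'M[R]_n).

Lemma nth_sparse_rows (i : 'I_n) :
  nth [::] (sparse_rows P) i = [seq (val j, P i j) | j <- enum 'I_n & P i j != 0].
Proof.
by rewrite /sparse_rows (nth_map i) ?size_enum_ord// nth_ord_enum.
Qed.

Lemma entry_sparse_rows (i j : 'I_n) : entry (nth [::] (sparse_rows P) i) j = P i j.
Proof.
rewrite nth_sparse_rows /entry big_map big_filter_cond/= big_mkcondl/=.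
rewrite big_enum_cond/=.
rewrite (bigD1 j)//= big1 ?addr0 => [|k /andP[/eqP/val_inj -> /eqP//]].
by case: eqP => //= ->.
Qed.

Lemma indices_below_sparse_rows (i : 'I_n) :
  indices_below n (nth [::] (sparse_rows P) i).
Proof. by rewrite nth_sparse_rows /indices_below all_map; apply/allP => j _ /=. Qed.

Lemma size_sparse_rows (i : 'I_n) :
  size (nth [::] (sparse_rows P) i) = #|[set j | P i j != 0]|.
Proof.
rewrite nth_sparse_rows size_map cardsE cardE; congr size.
by rewrite /enum_mem -filter_predI; apply: eq_filter => j; rewrite /= andbT.
Qed.

End SparseMatrix.

(** * One iteration of the program *)

Section Distributions.
Variables (R : realType) (m : nat).

Definition law_of_weights (q : nat -> R) : 'cV[R]_m := normalize (\col_i q i).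

Lemma law_of_weightsE (q : nat -> R) (i : 'I_m) :
  law_of_weights q i 0 = (\sum_(k < m) q k)^-1 * q i.
Proof.
rewrite /law_of_weights /normalize !mxE; congr (_^-1 * _).
by apply: eq_bigr => k _; rewrite mxE.
Qed.

Lemma law_of_weights_reweight (q r : nat -> R) (x : 'I_m -> R) : (0 < m)%N ->
  (forall i, 0 < q i) -> (forall i : 'I_m, r i = q i * expR (x i)) ->
  normalize (\col_i (law_of_weights q i 0 * expR (x i))) = law_of_weights r.
Proof.
move=> m0 q0 rE; have s0 := sum_gt0 m0 q0.
have -> : \col_i (law_of_weights q i 0 * expR (x i)) = (\sum_(k < m) q k)^-1 *: (\col_i r i).
  by apply/colP => i; rewrite [LHS]mxE law_of_weightsE [RHS]mxE [in RHS]mxE rE mulrA.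
rewrite /law_of_weights /normalize.
under [X in X^-1 *: _]eq_bigr do rewrite mxE.
rewrite -mulr_sumr scalerA invfM -mulrA [X in _ * X]mulrC mulrA invrK.
by rewrite mulfV ?mul1r// gt_eqF.
Qed.

(** The trees are never normalized, so they determine the current distribution only up
    to a positive factor. *)
Definition stores (q : 'cV[R]_m) (t : wtree R) : Prop :=
  exists r, [/\ forall i, 0 < r i, represents m r t & q = law_of_weights r].

Lemma stores_reweight (q : 'cV[R]_m) (r : nat -> R) (x : 'I_m -> R) (y : nat -> R)
    (t : wtree R) : (0 < m)%N ->
  (forall i, 0 < r i) -> q = law_of_weights r -> (forall i : 'I_m, y i = x i) ->
  represents m (fun i => r i * expR (y i)) t ->
  stores (normalize (\col_i (q i 0 * expR (x i)))) t.
Proof.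
move=> m0 r0 -> yx rt; exists (fun i => r i * expR (y i)); split=> //.
  by move=> i; rewrite mulr_gt0// expR_gt0.
by apply: law_of_weights_reweight => // i; rewrite yx.
Qed.

Lemma sample_stored_mean (q : 'cV[R]_m) (t : wtree R) (F : nat -> R) :
  stores q t -> mean F (sample_leaf m t) = \sum_i q i 0 * F i.
Proof.
move=> [r [r0 rt ->]]; rewrite (sample_leaf_mean F r0 rt).
by apply: eq_bigr => i _; rewrite law_of_weightsE.
Qed.

Lemma sample_stored_cost (q : 'cV[R]_m) (t : wtree R) (K : nat -> nat) (B : nat) :
  stores q t -> (forall i : 'I_m, (K i <= B)%N) ->
  (cost K (sample_leaf m t) <= 3 * up_log 2 m + 1 + B)%N.
Proof.
move=> [r [_ rt _]] KB; apply: (sample_leaf_cost rt) => i im.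
exact: (KB (Ordinal im)).
Qed.

Lemma build_tree_stores (w : R) : (0 < m)%N -> 0 < w ->
  terminates (build_tree m m w) (3 * m) (stores (const_mx m%:R^-1)).
Proof.
move=> m0 w0; apply: (@terminatesW _ _ _ (3 * m - 2)); last lia.
apply: terminates_imp (build_tree_spec w m0 (leqnn m)) => t ht.
exists (fun=> w); split=> //; apply/colP => i; rewrite mxE law_of_weightsE sumr_const card_ord.
rewrite -[w *+ m]mulr_natr invfM mulrAC mulVf ?mul1r//; exact: lt0r_neq0.
Qed.

End Distributions.

Section Iteration.
Variables (R : realType) (n : nat) (P : 'M[R]_n) (gx gy : R).
Let rows := sparse_rows P.
Let cols := sparse_cols P.

Local Open Scope prog_scope.
(** One iteration after its two draws, so that the random and the deterministic parts
    can be treated separately. *)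
Definition loop_tail (k : nat) (tp tpi : wtree R) (sx sy : seq R) (i j : nat) :
    prog R (seq R * seq R) :=
  let! sx' := incr_cell sx j in
  let! sy' := incr_cell sy i in
  if k == 0%N then Ret (sx', sy') else
    let! row := sub_unit j (nth [::] rows j) in
    let! tpi' := update_pi n gy row tpi in
    let c := if (i < n)%N then i else (i - n)%N in
    let! col := sub_unit c (nth [::] cols c) in
    let! g := (if (i < n)%N then op (Defs.Sub 0 gx) else Ret gx) in
    let! tp' := update_p n g col tp in
    GK_loop n rows cols gx gy k tp' tpi' sx' sy'.

Lemma GK_loopS k tp tpi sx sy :
  GK_loop n rows cols gx gy k.+1 tp tpi sx sy =
  Step (let! i := sample_leaf (n + n) tpi in
        let! j := sample_leaf n tp in
        loop_tail k tp tpi sx sy i j).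
Proof. by []. Qed.
Local Close Scope prog_scope.

(** At most [d + 1 <= d + d] entries in the row and in the column; each entry costs two
    updates of a leaf in the larger tree, respectively one in the smaller tree. *)
Definition update_cost (d : nat) : nat := d * (12 * up_log 2 (n + n) + 35).

(** Entries of [P - 1%:M] outside the sparse row or column are 0, so the leaves that
    are not visited have the factor 1 of the multiplicative update. *)
Lemma loop_tail_spec (d k : nat) tp tpi sx sy pi p (i : 'I_(n + n)) (j : 'I_n) :
  is_sparse d P -> (0 < d)%N -> (0 < k)%N -> stores pi tpi -> stores p tp ->
  exists tp' tpi', [/\ stores (next_pi P gy pi j) tpi', stores (next_p P gx p i) tp',
    forall F, mean F (loop_tail k tp tpi sx sy i j) =
      mean F (GK_loop n rows cols gx gy k tp' tpi' (incr sx j) (incr sy i)) &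
    forall K, (cost K (loop_tail k tp tpi sx sy i j) <= 4 + update_cost d +
      cost K (GK_loop n rows cols gx gy k tp' tpi' (incr sx j) (incr sy i)))%N].
Proof.
move=> [dr dc] d0 k0 [rpi [rpi0 tpiE piE]] [rp [rp0 tpE pE]].
have n0 : (0 < n)%N by case: (n) j => [[]|].
pose c := if (i < n)%N then (i : nat) else (i - n)%N.
have cn : (c < n)%N by rewrite /c; case: (ltnP i n) => // ni; rewrite ltn_subLR.
pose co := Ordinal cn.
have [row [[rs rb re] rF rK]] :=
  terminates_run (sub_unit_spec (ltn_ord j) (indices_below_sparse_rows P j)).
have [tpi' [tpi'E piF piK]] := terminates_run (update_pi_spec gy rb tpiE).
have [col [[cs cb ce] cF cK]] :=
  terminates_run (sub_unit_spec (ltn_ord co) (indices_below_sparse_rows P^T co)).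
pose g := if (i < n)%N then - gx else gx.
have gs : terminates (if (i < n)%N then op (Defs.Sub 0 gx) else Ret gx) 1 (eq g).
  by rewrite /g; case: ifP => _ //=; rewrite sub0r.
have [g' [gE gF gK]] := terminates_run gs.
have [tp' [tp'E pF pK]] := terminates_run (update_p_spec g' cb tpE).
exists tp', tpi'; split.
- apply: (stores_reweight (m := n + n) _ rpi0 piE _ tpi'E); first by lia.
  move=> i'; congr (_ * _); rewrite /signed_entry.
  case: (split_ordP i') => b ->.
    rewrite /= re entry_sparse_rows game_mxl; congr (_ - _%:R).
  rewrite /= addKn re entry_sparse_rows game_mxr.
  by congr (- (_ - _%:R)).
- apply: (stores_reweight (m := n) _ rp0 pE _ tp'E) => // j'.
  rewrite ce entry_sparse_rows mxE -gE /g eq_sym.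
  case: (ltnP i n) => iN.
    have iE : i = lshift n co by apply: val_inj; rewrite /= /c iN.
    by rewrite [X in game_mx P j' X]iE game_mxl.
  have iE : i = rshift n co.
    by apply: val_inj; rewrite /= /c ltnNge iN/= subnKC.
  by rewrite [X in game_mx P j' X]iE game_mxr mulrNN.
- move=> F; rewrite /loop_tail !mean_bind/= (gtn_eqF k0) .
  by rewrite mean_bind rF mean_bind piF mean_bind cF mean_bind gF mean_bind pF.
- move=> K; rewrite /loop_tail /= (gtn_eqF k0).
  have rd := dr j; have cd : (size (nth [::] (sparse_rows P^T) co) <= d)%N.
    rewrite size_sparse_rows; apply: leq_trans (dc co).
    by apply: eq_leq; apply: eq_card => b; rewrite !inE mxE.
  rewrite -size_sparse_rows in rd.
  set B := cost K (GK_loop _ _ _ _ _ _ _ _ _ _).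
  set T := cost K _.
  have : (T <= (size (nth [::] (sparse_rows P) j)).+1 +
    (size row * (4 * up_log 2 (n + n) + 9) + 1 +
    ((size (nth [::] (sparse_rows P^T) co)).+1 +
     (1 + (size col * (2 * up_log 2 n + 5) + 1 + B)))))%N.
    rewrite /T cost_bind (leq_trans (rK _))// leq_add2l.
    rewrite cost_bind (leq_trans (piK _))// leq_add2l.
    rewrite cost_bind (leq_trans (cK _))// leq_add2l.
    rewrite cost_bind (leq_trans (gK _))// leq_add2l.
    by rewrite cost_bind (leq_trans (pK _))// leq_add2l.
  have lgn : (up_log 2 n <= up_log 2 (n + n))%N by rewrite leq_up_log// leq_addr.
  have : (size row * (4 * up_log 2 (n + n) + 9) <= (d + d) * (4 * up_log 2 (n + n) + 9))%N.
    by rewrite leq_mul2r; apply/orP; right; lia.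
  have : (size col * (2 * up_log 2 n + 5) <= (d + d) * (2 * up_log 2 (n + n) + 5))%N.
    by apply: leq_mul; lia.
  rewrite /update_cost; move: (up_log 2 (n + n)) => u.
  nia.
Qed.

End Iteration.

(** * Law and running time of the whole program *)

Section Loop.
Variables (R : realType) (n d : nat) (P : 'M[R]_n) (gx gy : R).
Hypotheses (sP : is_sparse d P) (d0 : (0 < d)%N).
Let rows := sparse_rows P.
Let cols := sparse_cols P.

Definition visits_x (sx : seq R) (w : seq (draws n)) : seq R :=
  foldl (fun s (a : draws n) => incr s a.2) sx w.
Definition visits_y (sy : seq R) (w : seq (draws n)) : seq R :=
  foldl (fun s (a : draws n) => incr s a.1) sy w.

(** By induction on [k]. The loop stops updating after its last draw, in accordance
    with [path_prob], which involves a distribution only to draw from it. *)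
Lemma GK_loop_mean (F : seq R * seq R -> R) k tp tpi sx sy
    (pi : 'cV[R]_(n + n)) (p : 'cV[R]_n) :
  stores pi tpi -> stores p tp ->
  mean F (GK_loop n rows cols gx gy k.+1 tp tpi sx sy) =
  \sum_(w : k.+1.-tuple (draws n))
    path_prob P gx gy pi p w * F (visits_x sx w, visits_y sy w).
Proof.
elim: k tp tpi sx sy pi p => [|k IH] tp tpi sx sy pi p spi sp.
  rewrite (sum_drawsS 0
    (fun w => path_prob P gx gy pi p w * F (visits_x sx w, visits_y sy w))).
  rewrite GK_loopS [LHS]/= mean_bind (sample_stored_mean _ spi); apply: eq_bigr => i _.
  rewrite mean_bind (sample_stored_mean _ sp) mulr_sumr; apply: eq_bigr => j _.
  rewrite (sum_tuple0 (fun w => path_prob P gx gy pi p ((i, j) :: w) *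
    F (visits_x sx ((i, j) :: w), visits_y sy ((i, j) :: w)))).
  by rewrite [path_prob _ _ _ _ _ _]/= mulr1 mulrA.
rewrite (sum_drawsS k.+1
    (fun w => path_prob P gx gy pi p w * F (visits_x sx w, visits_y sy w))).
rewrite GK_loopS [LHS]/= mean_bind (sample_stored_mean _ spi); apply: eq_bigr => i _.
rewrite mean_bind (sample_stored_mean _ sp) mulr_sumr; apply: eq_bigr => j _.
have [tp' [tpi' [spi' sp' -> _]]] :=
  loop_tail_spec gx gy sx sy i j sP d0 (ltn0Sn k) spi sp.
rewrite (IH _ _ _ _ _ _ spi' sp') mulrA mulr_sumr; apply: eq_bigr => w _.
by rewrite mulrA.
Qed.

Lemma incr_size (s : seq R) m (i : 'I_m) : size s = m -> size (incr s i) = m.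
Proof. by move=> sm; rewrite size_set_nth sm; apply/maxn_idPr. Qed.

(** Only [k] of the [k.+1] iterations update the weights. *)
Lemma GK_loop_cost (K : seq R * seq R -> nat) (B : nat) k tp tpi sx sy
    (pi : 'cV[R]_(n + n)) (p : 'cV[R]_n) :
  (forall s1 s2, size s1 = n -> size s2 = (n + n)%N -> (K (s1, s2) <= B)%N) ->
  stores pi tpi -> stores p tp -> size sx = n -> size sy = (n + n)%N ->
  (cost K (GK_loop n rows cols gx gy k.+1 tp tpi sx sy) <=
    k.+1 * (6 * up_log 2 (n + n) + 7) + k * update_cost n d + B)%N.
Proof.
move=> KB; elim: k tp tpi sx sy pi p => [|k IH] tp tpi sx sy pi p spi sp sxn syn.
all: have lgn : (up_log 2 n <= up_log 2 (n + n))%N by rewrite leq_up_log// leq_addr.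
all: rewrite GK_loopS [leqLHS]/= cost_bind.
  apply: (@leq_trans (3 * up_log 2 (n + n) + 1 + (3 * up_log 2 n + 1 + (4 + B))).+1);
    last by lia.
  apply: (sample_stored_cost spi) => i; rewrite cost_bind.
  apply: (sample_stored_cost sp) => j.
  have : (K (incr sx j, incr sy i) <= B)%N by apply: KB; exact: incr_size.
  by rewrite -(leq_add2l 4).
apply: (@leq_trans (3 * up_log 2 (n + n) + 1 + (3 * up_log 2 n + 1 +
  (4 + update_cost n d + (k.+1 * (6 * up_log 2 (n + n) + 7) + k * update_cost n d + B)))).+1);
    last by rewrite !mulSn; lia.
apply: (sample_stored_cost spi) => i; rewrite cost_bind.
apply: (sample_stored_cost sp) => j.
have [tp' [tpi' [spi' sp' _ Kt]]] :=
  loop_tail_spec gx gy sx sy i j sP d0 (ltn0Sn k) spi sp.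
apply: leq_trans (Kt K) _; rewrite leq_add2l.
by apply: IH spi' sp' _ _; exact: incr_size.
Qed.

End Loop.

Section Program.
Variables (R : realType) (n d N : nat) (P : 'M[R]_n).
Hypotheses (sP : is_sparse d P) (d0 : (0 < d)%N) (n0 : (0 < n)%N) (N0 : (0 < N)%N).
Let rows := sparse_rows P.
Let cols := sparse_cols P.
Let gx : R := Num.sqrt (2 * ln n%:R / N%:R).
Let gy : R := Num.sqrt (2 * ln (2 * n)%:R / N%:R).

Definition averages_of_counts (s : seq R * seq R) : 'cV[R]_n * 'cV[R]_(n + n) :=
  (col_of_seq n [seq v / N%:R | v <- s.1], col_of_seq (n + n) [seq v / N%:R | v <- s.2]).

Lemma col_of_counts (m : nat) (f : draws n -> 'I_m) (w : N.-tuple (draws n)) :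
  col_of_seq m [seq v / N%:R | v <- foldl (fun s a => incr s (f a)) (nseq m 0) w] =
  N%:R^-1 *: \sum_(k < N) delta_mx (f (tnth w k)) 0 :> 'cV[R]_m.
Proof.
apply/colP => i; rewrite !mxE (nth_map 0); last first.
  by rewrite foldl_incr_size size_nseq.
rewrite nth_foldl_incr nth_nseq ltn_ord add0r mulrC summxE big_tuple; congr (_ * _).
by apply: eq_bigr => k _; rewrite !mxE andbT eq_sym val_eqE.
Qed.

Lemma averages_of_visits (w : N.-tuple (draws n)) :
  averages_of_counts
    (visits_x (nseq n (0 : R)) w, visits_y (nseq (n + n) (0 : R)) w) = averages R w.
Proof. by rewrite /averages_of_counts !col_of_counts. Qed.

(** All that surrounds the loop is deterministic, so the program reduces to its loop,
    started from trees that store the uniform distributions. *)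
Lemma GK_program_spec : exists tp tpi, [/\
  stores (const_mx (n + n)%:R^-1 : 'cV[R]_(n + n)) tpi,
  stores (const_mx n%:R^-1 : 'cV[R]_n) tp,
  forall F, mean F (GK_program n rows cols N) =
    mean (fun s => F (averages_of_counts s))
      (GK_loop n rows cols gx gy N tp tpi (nseq n (0%R : R)) (nseq (n + n) (0%R : R))) &
  forall K, (cost K (GK_program n rows cols N) <= 12 * n + 10 +
    cost (fun s => 2 * size s.1 + 2 * size s.2 + K (averages_of_counts s))
      (GK_loop n rows cols gx gy N tp tpi (nseq n (0%R : R)) (nseq (n + n) (0%R : R))))%N].
Proof.
have nn0 : (0 < n + n)%N by rewrite addn_gt0 n0.
have pos m : (0 < m)%N -> (0 : R) < 1 / m%:R by move=> m0; rewrite divr_gt0// ltr0n.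
have [_ [<- gxF gxK]] := terminates_run (step_size_spec R n N).
have [_ [<- gyF gyK]] := terminates_run (step_size_spec R (2 * n) N).
have [tp [sp pF pK]] := terminates_run (build_tree_stores n0 (pos n n0)).
have [tpi [spi piF piK]] := terminates_run (build_tree_stores nn0 (pos _ nn0)).
have [_ [<- xF xK]] := terminates_run (fill_spec n (0 : R)).
have [_ [<- yF yK]] := terminates_run (fill_spec (n + n) (0 : R)).
exists tp, tpi; split=> //.
- move=> F; rewrite /GK_program mean_bind gxF mean_bind gyF mean_bind [LHS]/=.
  rewrite mean_bind pF /= mean_bind piF mean_bind xF mean_bind yF mean_bind.
  apply: eq_mean => -[s1 s2] /=.
  have [_ [<- F1 _]] := terminates_run (divide_cells_spec s1 (N%:R : R)).
  have [_ [<- F2 _]] := terminates_run (divide_cells_spec s2 (N%:R : R)).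
  by rewrite mean_bind F1 mean_bind F2.
move=> K; rewrite /GK_program.
have loopK tp1 tpi1 sx sy : (cost (fun s => cost K
   (bind (divide_cells s.1 (N%:R : R)) (fun xbar => bind (divide_cells s.2 (N%:R : R))
     (fun ybar => Ret (col_of_seq n xbar, col_of_seq (n + n) ybar)))))
     (GK_loop n rows cols gx gy N tp1 tpi1 sx sy) <=
   cost (fun s => 2 * size s.1 + 2 * size s.2 + K (averages_of_counts s))
     (GK_loop n rows cols gx gy N tp1 tpi1 sx sy))%N.
  apply: leq_cost => -[s1 s2] /=.
  have [_ [<- _ K1]] := terminates_run (divide_cells_spec s1 (N%:R : R)).
  have [_ [<- _ K2]] := terminates_run (divide_cells_spec s2 (N%:R : R)).
  rewrite cost_bind (leq_trans (K1 _))// -addnA leq_add2l.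
  by rewrite cost_bind (leq_trans (K2 _)).
set L := cost _ (GK_loop _ _ _ _ _ _ _ _ _ _).
apply: (@leq_trans (4 + (4 + (1 + (3 * n + (1 + (3 * (n + n) + (n + ((n + n) + L)))))))));
  last lia.
rewrite cost_bind (leq_trans (gxK _))// leq_add2l.
rewrite cost_bind (leq_trans (gyK _))// leq_add2l.
rewrite ?cost_bind [leqLHS]/= ltnS.
rewrite cost_bind (leq_trans (pK _))// leq_add2l.
rewrite ?cost_bind [leqLHS]/= ltnS.
rewrite cost_bind (leq_trans (piK _))// leq_add2l.
rewrite cost_bind (leq_trans (xK _))// leq_add2l.
rewrite cost_bind (leq_trans (yK _))// leq_add2l.
rewrite cost_bind; exact: loopK.
Qed.

Lemma GK_program_law (E : pred ('cV[R]_n * 'cV[R]_(n + n))) :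
  prog_prob E (GK_program n rows cols N) = GK_prob P gx gy N E.
Proof.
have [tp [tpi [spi sp PF _]]] := GK_program_spec.
have := GK_loop_mean gx gy sP d0
  (fun s => (E (averages_of_counts s))%:R) N.-1 (nseq n 0) (nseq (n + n) 0) spi sp.
rewrite prog_prob_mean PF (prednK N0) => ->.
rewrite /GK_prob [RHS]big_mkcond; apply: eq_bigr => w _.
by rewrite averages_of_visits; case: (E _); rewrite ?mulr1 ?mulr0.
Qed.

Lemma GK_program_time : (run_time (GK_program n rows cols N) <=
  18 * n + 10 + N * (6 * up_log 2 (n + n) + 7) + N.-1 * update_cost n d)%N.
Proof.
have [tp [tpi [spi sp _ PK]]] := GK_program_spec.
rewrite run_time_cost (leq_trans (PK _))//.
have := @GK_loop_cost R n d P gx gy sP d0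
  (fun s => 2 * size s.1 + 2 * size s.2 + 0)%N (6 * n) N.-1 tp tpi
  (nseq n (0%R : R)) (nseq (n + n) (0%R : R)) _ _ _ spi sp
  (size_nseq _ _) (size_nseq _ _).
rewrite prednK// => h.
apply: leq_trans (leq_add (leqnn _) (h _)) _; first by move=> s1 s2 /= -> ->; lia.
lia.
Qed.

End Program.

(** * The bound on the running time *)

Lemma ln2_ge (R : realType) : 2^-1 <= ln 2 :> R.
Proof.
have := @le_ln1Dx R (- 2^-1) ltac:(lra).
have -> : 1 + - 2^-1 = 2^-1 :> R by field.
by rewrite lnV ?posrE// lerN2.
Qed.

(** The height [h] of the larger tree satisfies [2 ^ (h - 1) < 2 * n], so
    [h <= 2 + ln n / ln 2]; the constant term is absorbed as [ln n >= ln 2 >= 1 / 2]. *)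
Lemma up_log2_double_le (R : realType) (n : nat) : (1 < n)%N ->
  (up_log 2 (n + n))%:R <= 6 * ln n%:R :> R.
Proof.
move=> n1; have l2 := ln2_ge R.
have lb : ln 2 <= ln n%:R :> R by rewrite ler_ln ?posrE ?ltr0n ?ler_nat//; lia.
have := @up_log_gtn 2 (n + n) isT ltac:(lia).
set h := up_log 2 (n + n) => hlt.
have h0 : (0 < h)%N by rewrite up_log_gt0; lia.
have : h.-1%:R * ln 2 <= ln 2 + ln n%:R :> R.
  rewrite -lnM ?posrE ?ltr0n//; last by lia.
  rewrite mulr_natl -lnXn// -natrX -natrM ler_ln ?posrE ?ltr0n ?expn_gt0//; last by lia.
  by rewrite ler_nat; lia.
have -> : h%:R = h.-1%:R + 1 :> R by rewrite natr1 prednK.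
have : (0 : R) <= h.-1%:R by [].
nra.
Qed.

Lemma sparsity_gt0 (R : realType) (n d : nat) (P : 'M[R]_n) : (0 < n)%N ->
  is_transition_matrix P -> is_sparse d P -> (0 < d)%N.
Proof.
move=> n0 [_ P1] [dr _]; have := dr (Ordinal n0); apply: leq_trans.
rewrite lt0n cards_eq0; apply/eqP => E; have /eqP := P1 (Ordinal n0).
rewrite big1 ?(eq_sym 0) ?oner_eq0// => j _; apply/eqP/negPn.
by move/finset.setP/(_ j): E; rewrite !finset.inE => ->.
Qed.

(** [12288 = 64 * 192]: [N - 1] is at most [64 * ln (n / delta) / eps ^+ 2], and an
    iteration costs at most [192 * d * ln n]. *)
Lemma GK_program_time_bound (R : realType) (n d N : nat) (P : 'M[R]_n) (eps delta : R) :
  (1 < n)%N -> is_transition_matrix P -> is_sparse d P ->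
  0 < eps -> 0 < delta -> delta < 1 -> (0 < N)%N ->
  N.-1%:R <= 4 * eps ^- 2 * (ln (2 * n)%:R + ln n%:R + 16 * ln (1 / delta)) ->
  (run_time (GK_program n (sparse_rows P) (sparse_cols P) N))%:R <=
    12288 * (n%:R + d%:R * ln n%:R * ln (n%:R / delta) / eps ^+ 2).
Proof.
move=> n1 tP sP e0 de0 de1 N0 hN; have n0 : (0 < n)%N by lia.
have d0 := sparsity_gt0 n0 tP sP.
have h2n : (up_log 2 (n + n) <= n + n)%N by rewrite up_log_min// ltnW// ltn_expl.
have hL := up_log2_double_le R n1.
have l2 := ln2_ge R.
have n0R : (0 : R) < n%:R by rewrite ltr0n.
have lb : ln 2 <= ln n%:R :> R by rewrite ler_ln ?posrE ?ler_nat.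
have c0 : 0 < ln (1 / delta) by rewrite ln_gt0// ltr_pdivlMr// mul1r.
have nat_bound : (run_time (GK_program n (sparse_rows P) (sparse_cols P) N) <=
    47 * n + N.-1 * (d * (18 * up_log 2 (n + n) + 42)))%N.
  apply: leq_trans (GK_program_time sP d0 n0 N0) _.
  rewrite -{1}(prednK N0) /update_cost; move: (N.-1) (up_log _ _) h2n => M u un.
  (* The last iteration makes no update; its own cost is absorbed by [47 * n]. *)
  have : (M * (6 * u + 7) <= M * (d * (6 * u + 7)))%N.
    by rewrite leq_mul2l leq_pmull ?orbT.
  nia.
rewrite (le_trans (y := 47 * n%:R + N.-1%:R * (d%:R * (192 * ln n%:R))))//.
  apply: (@le_trans _ _ (47 * n + N.-1 * (d * (18 * up_log 2 (n + n) + 42)))%:R).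
    by rewrite ler_nat.
  rewrite natrD !natrM lerD2l ler_wpM2l// ler_wpM2l// natrD natrM; lra.
set L := ln n%:R in hL lb hN *.
have E : ln (n%:R / delta) = L + ln (1 / delta).
  by rewrite -lnM ?posrE ?divr_gt0// mulrA mulr1.
have hN2 : N.-1%:R <= 64 * (ln (n%:R / delta) / eps ^+ 2).
  apply: le_trans hN _.
  have -> : 64 * (ln (n%:R / delta) / eps ^+ 2) =
      4 * eps ^- 2 * (16 * ln (n%:R / delta)) by field; exact: lt0r_neq0.
  rewrite ler_wpM2l ?mulr_ge0 ?invr_ge0 ?exprn_ge0 ?(ltW e0)//.
  have -> : ln (2 * n)%:R = ln 2 + L :> R by rewrite natrM lnM ?posrE.
  by rewrite E; lra.
rewrite mulrDr; apply: lerD; first by rewrite ler_wpM2r//; lra.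
have -> : 12288 * (d%:R * L * ln (n%:R / delta) / eps ^+ 2) =
   64 * (ln (n%:R / delta) / eps ^+ 2) * (d%:R * (192 * L)).
  by field; exact: lt0r_neq0.
by rewrite ler_wpM2r// !mulr_ge0//; lra.
Qed.

Theorem theorem4p1 (R : realType) :
  exists C : R, 0 < C /\
  forall (n d : nat) (P : 'M[R]_n) (eps delta : R),
    (0 < n)%N -> is_transition_matrix P -> is_sparse d P ->
    0 < eps -> 0 < delta -> delta < 1 ->
    let A := residual_mx P in
    let enough (N : nat) : Prop :=
      4 * eps ^- 2 *
        (ln (2 * n)%:R + ln n%:R + 16 * ln (1 / delta)) <= N%:R in
    let gx (N : nat) : R := Num.sqrt (2 * ln n%:R / N%:R) in
    let gy (N : nat) : R := Num.sqrt (2 * ln (2 * n)%:R / N%:R) in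
    let program (N : nat) := GK_program n (sparse_rows P) (sparse_cols P) N in
    (forall N : nat, enough N ->
       1 - delta <=
         GK_prob P (gx N) (gy N) N (fun out => `|A *m out.1| <= eps)) /\
    (forall N : nat, enough N ->
       forall E : pred ('cV[R]_n * 'cV[R]_(n + n)),
         prog_prob E (program N) = GK_prob P (gx N) (gy N) N E) /\
    ((1 < n)%N -> forall N : nat, enough N ->
       (forall M : nat, enough M -> (N <= M)%N) ->
       (run_time (program N))%:R <=
         C * (n%:R + d%:R * ln n%:R * ln (n%:R / delta) / eps ^+ 2)).
Proof.
exists 12288; split=> [|n d P eps delta n0 tP sP e0 d0 d1 A enough gx gy program].
  by rewrite ltr0n.
have dpos := sparsity_gt0 n0 tP sP.
split; [|split].
- by move=> N hN; exact: GK_accuracy.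
- by move=> N hN E; apply: (GK_program_law sP dpos n0 (iteration_count_gt0 n0 e0 d0 d1 hN)).
- move=> n1 N hN Nmin; have N0 := iteration_count_gt0 n0 e0 d0 d1 hN.
  apply: (GK_program_time_bound n1 tP sP e0 d0 d1 N0); rewrite leNgt; apply/negP => lt.
  by have := Nmin N.-1 (ltW lt); rewrite leqNgt prednK// leqnn.
Qed.
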